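(* Let $\mathcal N=(\hat{\mathcal K},\hat{\mathcal B})$ be a model of $T^R$ and let $A\subseteq\hat{\mathcal K}$. Then $$\mathrm{dcl}_{\mathbb B}(A)=\mathrm{cl}(\mathrm{fdcl}_{\mathbb B}(A))=\sigma(\mathrm{fdcl}_{\mathbb B}(A)).$$
   Context: $L$ is a finite or countable first-order signature and $T$ is a complete first-order $L$-theory all of whose models have at least two elements. The randomization signature $L^R$ is the two-sorted continuous-logic signature with a sort $\mathbb K$ (random elements) and a sort $\mathbb B$ (events). It has: for each first-order $L$-formula $\varphi$ with $n$ free variables, an $n$-ary function symbol $[\![\varphi(\cdot)]\!]$ of sort $\mathbb K^n\to\mathbb B$; a $[0,1]$-valued unary predicate $\mu$ on $\mathbb B$; the Boolean operations $\top,\bot,\sqcap,\sqcup,\neg$ on $\mathbb B$; and distance predicates $d_{\mathbb B}$ and $d_{\mathbb K}$. Given $\mathcal M\models T$, a nice randomization of $\mathcal M$ is a pre-structure $(\mathcal K,\mathcal B)$ for $L^R$ together with an atomless probability space $(\Omega,\mathcal B,\mu)$ satisfying the following. (i) $\mathcal B$ is a $\sigma$-algebra on $\Omega$, with $\top,\bot,\sqcap,\sqcup,\neg$ interpreted as $\Omega$, $\emptyset$, $\cap$, $\cup$ and complement. (ii) $\mathcal K$ is a set of functions $\Omega\to M$. (iii) For each $L$-formula $\psi(\vec x)$ and each tuple $\vec a$ from $\mathcal K$, $[\![\psi(\vec a)]\!]=\{\omega:\mathcal M\models\psi(\vec a(\omega))\}\in\mathcal B$. (iv) $\mathcal B$ consists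 exactly of such events. (v) For each $L$-formula $\theta(u,\vec v)$ and each tuple $\vec b$ from $\mathcal K$, there is $a\in\mathcal K$ with $[\![\theta(a,\vec b)]\!]=[\![(\exists u\,\theta)(\vec b)]\!]$. (vi) $d_{\mathbb K}(a,b)=\mu[\![a\neq b]\!]$. (vii) $d_{\mathbb B}(\mathsf B,\mathsf C)=\mu(\mathsf B\triangle\mathsf C)$. Moreover, the pre-structure is pre-complete: its reduction, obtained by identifying elements at distance $0$, is already a complete metric structure. $T^R$ is the set of continuous $L^R$-sentences true in all nice randomizations of models of $T$. A model of $T^R$ is written $\mathcal N=(\hat{\mathcal K},\hat{\mathcal B})$, where $\hat{\mathcal K}$ is the sort-$\mathbb K$ part and $\hat{\mathcal B}$ is the sort-$\mathbb B$ part; $\hat{\mathcal B}$ is a Boolean algebra of events with probability $\mu$. In a continuous structure $\mathcal N$, an element $b$ is definable over a set $A$ if there are continuous formulas $\Phi_k(x,\vec a_k)$, with $\vec a_k$ finite tuples from $A$, such that $\Phi_k(x,\vec a_k)^{\mathcal N}$ converges uniformly in $x$ to the distance function $d(x,b)$ of the relevant sort. For $A\subseteq\hat{\mathcal K}$: - $\mathrm{dcl}_{\mathbb B}(A)$ is the set of elements of $\hat{\mathcal B}$ definable over $A$ in $\mathcal N$; - $\mathrm{fdcl}_{\mathbb B}(A)$ is the set of events $[\![\varphi(\vec{\mathbf a})]\!]$ with $\varphi(\vec v)$ a first-order $L$-formula and $\vec{\mathbf a}$ a tuple from $A$; - for $B\subseteq\hat{\mathcal B}$, $\mathrm{cl}(B)$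 is the closure of $B$ in the metric $d_{\mathbb B}$, and $\sigma(B)$ is the smallest $\sigma$-subalgebra of $\hat{\mathcal B}$ containing $B$. *)

(* Defs.v *)
From mathcomp Require Import all_boot all_order all_algebra.
From mathcomp Require Import all_classical all_reals all_analysis.

Set Implicit Arguments.
Unset Strict Implicit.
Unset Printing Implicit Defensive.

Import Order.TTheory GRing.Theory Num.Theory.
Import numFieldNormedType.Exports.
Local Open Scope classical_set_scope.
Local Open Scope ring_scope.

(** * Assignments of de Bruijn variables *)

Definition nil_env {X : Type} (i : 'I_0) : X := False_rect X (notF (ltn_ord i)).

(* The variable bound by a quantifier is number 0; the others are shifted. *)
Definition cons_env {X : Type} {n : nat} (x : X) (e : 'I_n -> X) :
    'I_n.+1 -> X :=
  fun i => if unlift ord0 i is Some j then e j else x.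

(** * First-order logic (with equality) *)

(* [countType] includes the finite types; constants are 0-ary functions. *)
Record signature := Signature {
  fsym : countType;
  fsym_arity : fsym -> nat;
  rsym : countType;
  rsym_arity : rsym -> nat }.

Inductive term (L : signature) (n : nat) : Type :=
| Var : 'I_n -> term L n
| App : forall f : fsym L, ('I_(fsym_arity f) -> term L n) -> term L n.
Arguments Var {L n}.
Arguments App {L n}.

(* [formula L n]: the L-formulas with free variables among x_0, ..., x_(n-1). *)
Inductive formula (L : signature) : nat -> Type :=
| Eq : forall n, term L n -> term L n -> formula L n
| Rel : forall n (r : rsym L), ('I_(rsym_arity r) -> term L n) -> formula L n
| Not : forall n, formula L n -> formula L n
| And : forall n, formula L n -> formula L n -> formula L n
| Or : forall n, formula L n -> formula L n -> formula L n
| Ex : forall n, formula L n.+1 -> formula L n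
| All : forall n, formula L n.+1 -> formula L n.

Record structure (L : signature) := Structure {
  carrier :> Type;
  carrier_inhabited : inhabited carrier;
  finterp : forall f : fsym L, ('I_(fsym_arity f) -> carrier) -> carrier;
  rinterp : forall r : rsym L, ('I_(rsym_arity r) -> carrier) -> Prop }.

Fixpoint teval (L : signature) (M : structure L) n (e : 'I_n -> M)
    (t : term L n) : M :=
  match t with
  | Var i => e i
  | App f ts => finterp (fun i => teval e (ts i))
  end.

Fixpoint sat (L : signature) (M : structure L) n (phi : formula L n) :
    ('I_n -> M) -> Prop :=
  match phi with
  | Eq _ s t => fun e => teval e s = teval e t
  | Rel _ r ts => fun e => rinterp (fun i => teval e (ts i))
  | Not _ p => fun e => ~ sat p e
  | And _ p q => fun e => sat p e /\ sat q e
  | Or _ p q => fun e => sat p e \/ sat q e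
  | Ex _ p => fun e => exists x, sat p (cons_env x e)
  | All _ p => fun e => forall x, sat p (cons_env x e)
  end.

Definition theory (L : signature) := set (formula L 0).

Definition models (L : signature) (M : structure L) (T : theory L) : Prop :=
  forall phi, T phi -> sat phi (nil_env : 'I_0 -> M).

Definition entails (L : signature) (T : theory L) (phi : formula L 0) : Prop :=
  forall M : structure L, models M T -> sat phi (nil_env : 'I_0 -> M).

Definition complete_theory (L : signature) (T : theory L) : Prop :=
  (exists M : structure L, models M T) /\
  (forall phi, entails T phi \/ entails T (Not phi)).

Definition models_have_two_elements (L : signature) (T : theory L) : Prop :=
  forall M : structure L, models M T -> exists x y : M, x <> y.

(** * Continuous logic in the randomization signature *)

(* The interpretations of the symbols of L^R; see [is_prestructure] for the
   conditions of continuous logic on them. *)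
Record interpretation (R : realType) (L : signature) := Interpretation {
  elt : Type;  (* the sort K of random elements *)
  evt : Type;  (* the sort B of events *)
  ev : forall n, formula L n -> ('I_n -> elt) -> evt;
  mu : evt -> R;
  etop : evt;
  ebot : evt;
  emeet : evt -> evt -> evt;
  ejoin : evt -> evt -> evt;
  eneg : evt -> evt;
  dK : elt -> elt -> R;
  dB : evt -> evt -> R }.
Arguments ev {R L i n}.
Arguments mu {R L i}.
Arguments etop {R L i}.
Arguments ebot {R L i}.
Arguments emeet {R L i}.
Arguments ejoin {R L i}.
Arguments eneg {R L i}.
Arguments dK {R L i}.
Arguments dB {R L i}.

Definition is_pseudometric01 (R : realType) (X : Type) (d : X -> X -> R) :=
  [/\ forall x y, 0 <= d x y <= 1,
      forall x, d x x = 0,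
      forall x y, d x y = d y x &
      forall x y z, d x z <= d x y + d y z].

(* The moduli of uniform continuity of the signature make every symbol
   1-Lipschitz in each of its arguments. *)
Record is_prestructure (R : realType) (L : signature)
    (N : interpretation R L) : Prop := {
  elt_inhabited : inhabited (elt N);
  dK_pseudometric : is_pseudometric01 (dK : elt N -> elt N -> R);
  dB_pseudometric : is_pseudometric01 (dB : evt N -> evt N -> R);
  mu_01 : forall b : evt N, 0 <= mu b <= 1;
  mu_modulus : forall b c : evt N, `|mu b - mu c| <= dB b c;
  ev_modulus : forall n (phi : formula L n) (a b : 'I_n -> elt N),
    dB (ev phi a) (ev phi b) <= \sum_(i < n) dK (a i) (b i);
  meet_modulus : forall b b' c c' : evt N,
    dB (emeet b c) (emeet b' c') <= dB b b' + dB c c';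
  join_modulus : forall b b' c c' : evt N,
    dB (ejoin b c) (ejoin b' c') <= dB b b' + dB c c';
  neg_modulus : forall b c : evt N, dB (eneg b) (eneg c) <= dB b c }.

Definition complete_dist (R : realType) (X : Type) (d : X -> X -> R) : Prop :=
  forall u : nat -> X,
    (forall e : R, 0 < e ->
       exists k0, forall k l, (k0 <= k)%N -> (k0 <= l)%N -> d (u k) (u l) < e) ->
    exists x, forall e : R, 0 < e -> \forall k \near \oo, d (u k) x < e.

(* Completeness of a pseudometric is completeness of its quotient by the
   relation [d x y = 0]. *)
Definition is_precomplete (R : realType) (L : signature)
    (N : interpretation R L) : Prop :=
  complete_dist (dK : elt N -> elt N -> R) /\
  complete_dist (dB : evt N -> evt N -> R).

Definition is_metric_structure (R : realType) (L : signature)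
    (N : interpretation R L) : Prop :=
  [/\ is_prestructure N, is_precomplete N,
      forall a b : elt N, dK a b = 0 -> a = b &
      forall b c : evt N, dB b c = 0 -> b = c].

Definition unit_cube (R : realType) (n : nat) : set 'rV[R]_n :=
  [set v | forall i, 0 <= v ord0 i <= 1].
Arguments unit_cube : clear implicits.

(* The continuous functions [0,1]^n -> [0,1]; values off the cube are junk. *)
Record connective (R : realType) (n : nat) := Connective {
  conn_fun :> 'rV[R]_n -> R;
  conn_continuous : {within unit_cube R n, continuous conn_fun};
  conn_01 : forall v, unit_cube R n v -> 0 <= conn_fun v <= 1 }.

(* Terms and formulas of L^R with free variables among [n] variables of sort K
   and [m] variables of sort B.  The only terms of sort K are variables. *)
Inductive bterm (L : signature) (n m : nat) : Type :=
| BVar : 'I_m -> bterm L n m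
| BEv : forall k, formula L k -> ('I_k -> 'I_n) -> bterm L n m
| BTop : bterm L n m
| BBot : bterm L n m
| BMeet : bterm L n m -> bterm L n m -> bterm L n m
| BJoin : bterm L n m -> bterm L n m -> bterm L n m
| BNeg : bterm L n m -> bterm L n m.

Inductive cformula (R : realType) (L : signature) : nat -> nat -> Type :=
| CMu : forall n m, bterm L n m -> cformula R L n m
| CdK : forall n m, 'I_n -> 'I_n -> cformula R L n m
| CdB : forall n m, bterm L n m -> bterm L n m -> cformula R L n m
| CConn : forall n m k, connective R k -> ('I_k -> cformula R L n m) ->
    cformula R L n m
| CSupK : forall n m, cformula R L n.+1 m -> cformula R L n m
| CInfK : forall n m, cformula R L n.+1 m -> cformula R L n m
| CSupB : forall n m, cformula R L n m.+1 -> cformula R L n m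
| CInfB : forall n m, cformula R L n m.+1 -> cformula R L n m.

Fixpoint bteval (R : realType) (L : signature) (N : interpretation R L) n m
    (a : 'I_n -> elt N) (b : 'I_m -> evt N) (t : bterm L n m) : evt N :=
  match t with
  | BVar i => b i
  | BEv _ phi xs => ev phi (fun i => a (xs i))
  | BTop => etop
  | BBot => ebot
  | BMeet s t => emeet (bteval a b s) (bteval a b t)
  | BJoin s t => ejoin (bteval a b s) (bteval a b t)
  | BNeg t => eneg (bteval a b t)
  end.

Fixpoint ceval (R : realType) (L : signature) (N : interpretation R L) n m
    (Phi : cformula R L n m) : ('I_n -> elt N) -> ('I_m -> evt N) -> R :=
  match Phi with
  | CMu _ _ t => fun a b => mu (bteval a b t)
  | CdK _ _ i j => fun a b => dK (a i) (a j)
  | CdB _ _ s t => fun a b => dB (bteval a b s) (bteval a b t)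
  | CConn _ _ _ u Ps => fun a b => u (\row_i ceval (Ps i) a b)
  | CSupK _ _ P => fun a b => sup (range (fun x => ceval P (cons_env x a) b))
  | CInfK _ _ P => fun a b => inf (range (fun x => ceval P (cons_env x a) b))
  | CSupB _ _ P => fun a b => sup (range (fun x => ceval P a (cons_env x b)))
  | CInfB _ _ P => fun a b => inf (range (fun x => ceval P a (cons_env x b)))
  end.

(* In continuous logic a sentence is true when its value is 0. *)
Definition ctrue (R : realType) (L : signature) (N : interpretation R L)
    (Phi : cformula R L 0 0) : Prop :=
  ceval Phi (nil_env : 'I_0 -> elt N) (nil_env : 'I_0 -> evt N) = 0.

(** * Nice randomizations and T^R *)

Definition atomless (R : realType) (d : measure_display)
    (Omega : measurableType d) (P : probability Omega R) : Prop :=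
  forall E : set Omega, measurable E -> (0 < P E)%E ->
    exists F : set Omega,
      [/\ measurable F, F `<=` E, (0 < P F)%E & (P F < P E)%E].

(* The formula x_0 <> x_1. *)
Definition neq_formula (L : signature) : formula L 2 :=
  Not (Eq (Var ord0) (Var ord_max)).

(* A set of functions Omega -> M is rendered as a type with an injective map
   [fK] to such functions, and likewise a set of subsets of Omega by [fB]. *)
Record nice_randomization_via (R : realType) (L : signature) (M : structure L)
    (N : interpretation R L) (d : measure_display) (Omega : measurableType d)
    (P : probability Omega R) (fK : elt N -> Omega -> M)
    (fB : evt N -> set Omega) : Prop := {
  nice_prestructure : is_prestructure N;
  nice_precomplete : is_precomplete N;
  nice_atomless : atomless P;
  nice_fB_inj : injective fB;
  nice_fB_range : range fB = measurable;
  nice_mu : forall b, (mu b)%:E = P (fB b);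
  nice_top : fB etop = setT;
  nice_bot : fB ebot = set0;
  nice_meet : forall b c, fB (emeet b c) = fB b `&` fB c;
  nice_join : forall b c, fB (ejoin b c) = fB b `|` fB c;
  nice_neg : forall b, fB (eneg b) = ~` fB b;
  nice_fK_inj : injective fK;
  nice_ev : forall n (psi : formula L n) (a : 'I_n -> elt N),
    fB (ev psi a) = [set w | sat psi (fun i => fK (a i) w)];
  nice_ev_surj : forall b : evt N,
    exists (n : nat) (psi : formula L n) (a : 'I_n -> elt N), b = ev psi a;
  nice_witness : forall n (theta : formula L n.+1) (b : 'I_n -> elt N),
    exists a : elt N, ev theta (cons_env a b) = ev (Ex theta) b;
  nice_dK : forall a b : elt N,
    dK a b = mu (ev (neq_formula L) (cons_env a (cons_env b nil_env)));
  nice_dB : forall b c : evt N, (dB b c)%:E = P (fB b `+` fB c) }.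

Definition nice_randomization (R : realType) (L : signature) (M : structure L)
    (N : interpretation R L) : Prop :=
  exists (d : measure_display) (Omega : measurableType d)
    (P : probability Omega R) (fK : elt N -> Omega -> M)
    (fB : evt N -> set Omega), nice_randomization_via P fK fB.

Definition randomization_theory (R : realType) (L : signature) (T : theory L) :
    set (cformula R L 0 0) :=
  [set Phi | forall (M : structure L) (N : interpretation R L),
     models M T -> nice_randomization M N -> ctrue N Phi].
Arguments randomization_theory R {L} T.

Definition is_model_of_randomization (R : realType) (L : signature)
    (T : theory L) (N : interpretation R L) : Prop :=
  is_metric_structure N /\
  forall Phi, randomization_theory R T Phi -> ctrue N Phi.

(** * Definable closure, closure and generated sigma-algebra *)

Section Closures.
Context {R : realType} {L : signature} {N : interpretation R L}.

Definition event_definable_over (A : set (elt N)) (b : evt N) : Prop :=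
  exists (n : nat -> nat) (Phi : forall k, cformula R L (n k) 1)
    (a : forall k, 'I_(n k) -> elt N),
    (forall k i, A (a k i)) /\
    (forall e : R, 0 < e -> \forall k \near \oo, forall x : evt N,
       `|ceval (Phi k) (a k) (cons_env x nil_env) - dB x b| < e).

Definition dclB (A : set (elt N)) : set (evt N) :=
  [set b | event_definable_over A b].

Definition fdclB (A : set (elt N)) : set (evt N) :=
  [set b | exists (n : nat) (phi : formula L n) (a : 'I_n -> elt N),
     (forall i, A (a i)) /\ b = ev phi a].

Definition clB (S : set (evt N)) : set (evt N) :=
  [set b | forall e : R, 0 < e -> exists c, S c /\ dB b c < e].

Definition ele (b c : evt N) : Prop := emeet b c = b.

Definition is_esup (u : nat -> evt N) (s : evt N) : Prop :=
  (forall k, ele (u k) s) /\ (forall c, (forall k, ele (u k) c) -> ele s c).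

Record sigma_subalgebra (S : set (evt N)) : Prop := {
  sub_top : S etop;
  sub_bot : S ebot;
  sub_meet : forall b c, S b -> S c -> S (emeet b c);
  sub_join : forall b c, S b -> S c -> S (ejoin b c);
  sub_neg : forall b, S b -> S (eneg b);
  sub_sup : forall (u : nat -> evt N) (s : evt N),
    (forall k, S (u k)) -> is_esup u s -> S s }.

Definition sigmaB (S : set (evt N)) : set (evt N) :=
  \bigcap_(S' in [set S' | sigma_subalgebra S' /\ S `<=` S']) S'.

End Closures.

(* Main.v *)
(** Every continuous formula Phi(x, a) is, up to eps and uniformly over all nice
    randomizations, determined by the measures of finitely many events
    [[psi(a)]], x /\ [[psi(a)]] (approximate quantifier elimination: a new event
    or random element is transported to a tuple with nearly the same law by
    splitting the cells of an atomless space proportionally). Replacing x in each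
    cell of the partition generated by the [[psi(a)]] by an event x' of the same
    measure and as far as possible from x does not change Phi by more than eps,
    while d(x, x') is at least the distance of x from some union of cells, which
    is itself of the form [[psi(a)]]. This is a property expressed by a sentence of
    T^R, so it holds in N; if Phi(x, a) approximates d(x, b), then at x = b it
    forces x' near b, hence b near an event [[psi(a)]]. The equality of the metric
    closure with the generated sigma-algebra comes from completeness: an
    increasing sequence of events is Cauchy, and its limit is its supremum. *)

Require Import Defs.
From mathcomp Require Import all_boot all_order all_algebra.
From mathcomp Require Import all_classical all_reals all_analysis.
From mathcomp Require Import ring lra.

Set Implicit Arguments.
Unset Strict Implicit.
Unset Printing Implicit Defensive.

Import Order.TTheory GRing.Theory Num.Theory.
Import numFieldNormedType.Exports.
Local Open Scope classical_set_scope.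
Local Open Scope ring_scope.

(** * Substitution, evaluation and transfer *)

Section Environments.
Context {X Y : Type}.

Lemma cons_env0 n (x : X) (e : 'I_n -> X) : cons_env x e ord0 = x.
Proof. by rewrite /cons_env unlift_none. Qed.

Lemma cons_env_lift n (x : X) (e : 'I_n -> X) i : cons_env x e (lift ord0 i) = e i.
Proof. by rewrite /cons_env liftK. Qed.

Lemma nil_envE (e : 'I_0 -> X) : e = nil_env.
Proof. by apply/funext => -[]. Qed.

Lemma cons_env_eta n (e : 'I_n.+1 -> X) :
  e = cons_env (e ord0) (fun i => e (lift ord0 i)).
Proof. by apply/funext => i; rewrite /cons_env; case: unliftP => [j|] ->. Qed.

Lemma cons_env_comp n (h : X -> Y) (x : X) (e : 'I_n -> X) :
  (fun i => h (cons_env x e i)) = cons_env (h x) (fun i => h (e i)).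
Proof. by apply/funext => i; rewrite /cons_env; case: unliftP. Qed.

End Environments.

Definition up_var {n n'} (f : 'I_n -> 'I_n') : 'I_n.+1 -> 'I_n'.+1 :=
  cons_env ord0 (fun i => lift ord0 (f i)).

Lemma cons_env_up X n n' (f : 'I_n -> 'I_n') (x : X) (e : 'I_n' -> X) :
  (fun i => cons_env x e (up_var f i)) = cons_env x (fun i => e (f i)).
Proof.
by rewrite /up_var cons_env_comp cons_env0; congr cons_env; apply/funext => i;
   rewrite cons_env_lift.
Qed.

Fixpoint rename_term L n n' (f : 'I_n -> 'I_n') (t : term L n) : term L n' :=
  match t with
  | Var i => Var (f i)
  | App g ts => App g (fun i => rename_term f (ts i))
  end.

Fixpoint rename_formula L n (phi : formula L n) :
    forall n', ('I_n -> 'I_n') -> formula L n' :=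
  match phi with
  | Eq _ s t => fun n' f => Eq (rename_term f s) (rename_term f t)
  | Rel _ r ts => fun n' f => Rel (fun i => rename_term f (ts i))
  | Not _ p => fun n' f => Not (rename_formula p f)
  | And _ p q => fun n' f => And (rename_formula p f) (rename_formula q f)
  | Or _ p q => fun n' f => Or (rename_formula p f) (rename_formula q f)
  | Ex _ p => fun n' f => Ex (rename_formula p (up_var f))
  | All _ p => fun n' f => All (rename_formula p (up_var f))
  end.

Lemma teval_rename L (M : structure L) n n' (f : 'I_n -> 'I_n') (e : 'I_n' -> M)
    (t : term L n) : teval e (rename_term f t) = teval (fun i => e (f i)) t.
Proof.
elim: t => [i|g ts ih] //=; congr finterp; apply/funext => i; exact: ih.
Qed.

Lemma sat_rename L (M : structure L) n (phi : formula L n) n' (f : 'I_n -> 'I_n')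
    (e : 'I_n' -> M) :
  sat (rename_formula phi f) e = sat phi (fun i => e (f i)).
Proof.
elim: phi n' f e => {n} [n s t|n r ts|n p ih|n p ihp q ihq|n p ihp q ihq|n p ih|n p ih]
  n' f e /=.
- by rewrite !teval_rename.
- by congr rinterp; apply/funext => i; rewrite teval_rename.
- by rewrite ih.
- by rewrite ihp ihq.
- by rewrite ihp ihq.
- by under eq_exists do rewrite ih cons_env_up.
- by under eq_forall do rewrite ih cons_env_up.
Qed.

(** The syntax has no truth constant and, when [n] is 0, perhaps no term at all; a quantified
    identity is available in every signature. *)
Definition true_formula L n : formula L n := All (Eq (Var ord0) (Var ord0)).
Definition big_and L n (s : seq (formula L n)) := foldr (@And L n) (true_formula L n) s.
Definition big_or L n (s : seq (formula L n)) :=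
  foldr (@Or L n) (Not (true_formula L n)) s.

Lemma sat_big_and L (M : structure L) n (I : finType) (F : I -> formula L n)
    (e : 'I_n -> M) :
  sat (big_and [seq F i | i <- enum I]) e <-> forall i, sat (F i) e.
Proof.
transitivity (forall i, i \in enum I -> sat (F i) e); last first.
  by split=> h i; [apply: h; rewrite mem_enum|move=> _].
elim: (enum I) => [|i s ih] /=; first by [].
rewrite ih; split=> [[h1 h2] j|h].
  by rewrite inE => /predU1P[->|/h2].
by split=> [|j js]; apply: h; rewrite inE ?eqxx // js orbT.
Qed.

Lemma sat_big_or L (M : structure L) n (I : finType) (h : pred I) (F : I -> formula L n)
    (e : 'I_n -> M) :
  sat (big_or [seq F i | i <- enum h]) e <-> exists2 i, h i & sat (F i) e.
Proof.
transitivity (exists2 i, i \in enum h & sat (F i) e); last first.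
  by split=> -[i hi Fi]; exists i => //; move: hi; rewrite mem_enum.
elim: (enum h) => [|i s ih] /=; first by split=> [nt|[]//]; exfalso; apply: nt.
rewrite ih; split=> [[Fi|[j js Fj]]|[j]].
- by exists i => //; rewrite inE eqxx.
- by exists j => //; rewrite inE js orbT.
- by rewrite inE => /predU1P[->|js Fj]; [left|right; exists j].
Qed.

(** An atom of the finite Boolean algebra generated by the [F i]; the atoms partition the space into
    cells. *)
Definition pattern_formula L n (I : finType) (F : I -> formula L n)
    (p : {ffun I -> bool}) : formula L n :=
  big_and [seq (if p i then F i else Not (F i)) | i <- enum I].

Definition sat_pattern L (M : structure L) n (I : finType) (F : I -> formula L n)
    (e : 'I_n -> M) : {ffun I -> bool} := [ffun i => `[< sat (F i) e >]].

Lemma sat_pattern_formula L (M : structure L) n (I : finType) (F : I -> formula L n)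
    (p : {ffun I -> bool}) (e : 'I_n -> M) :
  sat (pattern_formula F p) e <-> sat_pattern F e = p.
Proof.
rewrite sat_big_and; split=> [h|<- i].
  apply/ffunP => i; rewrite ffunE; move: (h i); case: (p i) => /= hi.
    exact/asboolP.
  exact/asboolPn.
by rewrite ffunE; case: asboolP.
Qed.

Fixpoint rename_bterm L n m m' (g : 'I_m -> 'I_m') (t : bterm L n m) : bterm L n m' :=
  match t with
  | BVar i => BVar L n (g i)
  | BEv _ phi xs => BEv m' phi xs
  | BTop => BTop L n m'
  | BBot => BBot L n m'
  | BMeet s t => BMeet (rename_bterm g s) (rename_bterm g t)
  | BJoin s t => BJoin (rename_bterm g s) (rename_bterm g t)
  | BNeg t => BNeg (rename_bterm g t)
  end.

(** Serves to place a formula about one event at either of the two event variables of the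
    perturbation sentence. *)
Fixpoint rename_cformula (R : realType) L n m (Phi : cformula R L n m) :
    forall m', ('I_m -> 'I_m') -> cformula R L n m' :=
  match Phi with
  | CMu _ _ t => fun m' g => CMu R (rename_bterm g t)
  | CdK _ _ i j => fun m' g => CdK R L m' i j
  | CdB _ _ s t => fun m' g => CdB R (rename_bterm g s) (rename_bterm g t)
  | CConn _ _ _ u Ps => fun m' g => CConn u (fun i => rename_cformula (Ps i) g)
  | CSupK _ _ P => fun m' g => CSupK (rename_cformula P g)
  | CInfK _ _ P => fun m' g => CInfK (rename_cformula P g)
  | CSupB _ _ P => fun m' g => CSupB (rename_cformula P (up_var g))
  | CInfB _ _ P => fun m' g => CInfB (rename_cformula P (up_var g))
  end.

Section Evaluation.
Context {R : realType} {L : signature} (N : interpretation R L).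

Lemma bteval_rename n m m' (g : 'I_m -> 'I_m') (a : 'I_n -> elt N)
    (b : 'I_m' -> evt N) (t : bterm L n m) :
  bteval a b (rename_bterm g t) = bteval a (fun i => b (g i)) t.
Proof. by elim: t => //= [s -> t ->|s -> t ->|t ->]. Qed.

Lemma ceval_rename n m (Phi : cformula R L n m) m' (g : 'I_m -> 'I_m')
    (a : 'I_n -> elt N) (b : 'I_m' -> evt N) :
  ceval (rename_cformula Phi g) a b = ceval Phi a (fun i => b (g i)).
Proof.
elim: Phi m' g a b => {n m} [n m t|n m i j|n m s t|n m k u Ps ih|n m P ih|n m P ih|n m P ih|n m P ih]
  m' g a b //=.
- by rewrite bteval_rename.
- by rewrite !bteval_rename.
- by congr (u _); apply/rowP => i; rewrite !mxE ih.
- by under eq_fun do rewrite ih.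
- by under eq_fun do rewrite ih.
- by under eq_fun do rewrite ih cons_env_up.
- by under eq_fun do rewrite ih cons_env_up.
Qed.

Hypothesis hN : is_prestructure N.

Lemma evt_inhabited : inhabited (evt N).
Proof. exact: (inhabits etop). Qed.

Lemma sup_range01 (X : Type) (f : X -> R) : inhabited X ->
  (forall x, 0 <= f x <= 1) ->
  0 <= sup (range f) <= 1 /\ forall x, f x <= sup (range f).
Proof.
move=> [x0] f01.
have hs : has_sup (range f).
  split; first by exists (f x0), x0.
  by exists 1 => _ [x _ <-]; case/andP: (f01 x).
have le_sup x : f x <= sup (range f) by apply: ub_le_sup; [exact: hs.2|exists x].
split=> //; apply/andP; split.
  by apply: le_trans (le_sup x0); case/andP: (f01 x0).
by apply: ge_sup; [exact: hs.1|move=> _ [x _ <-]; case/andP: (f01 x)].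
Qed.

Lemma inf_range01 (X : Type) (f : X -> R) : inhabited X ->
  (forall x, 0 <= f x <= 1) ->
  0 <= inf (range f) <= 1 /\ forall x, inf (range f) <= f x.
Proof.
move=> [x0] f01.
have hs : has_inf (range f).
  split; first by exists (f x0), x0.
  by exists 0 => _ [x _ <-]; case/andP: (f01 x).
have inf_le x : inf (range f) <= f x by apply: ge_inf; [exact: hs.2|exists x].
split=> //; apply/andP; split.
  by apply: lb_le_inf; [exact: hs.1|move=> _ [x _ <-]; case/andP: (f01 x)].
by apply: le_trans (inf_le x0) _; case/andP: (f01 x0).
Qed.

Lemma ceval01 n m (Phi : cformula R L n m) a b : 0 <= ceval (N := N) Phi a b <= 1.
Proof.
elim: Phi a b => {n m} [n m t|n m i j|n m s t|n m k u Ps ih|n m P ih|n m P ih|n m P ih|n m P ih]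
  a b /=.
- exact: mu_01 hN _.
- by case: (dK_pseudometric hN) => h _ _ _; exact: h.
- by case: (dB_pseudometric hN) => h _ _ _; exact: h.
- by apply: conn_01 => i; rewrite mxE; exact: ih.
- by case: (sup_range01 (elt_inhabited hN) (fun x => ih (cons_env x a) b)).
- by case: (inf_range01 (elt_inhabited hN) (fun x => ih (cons_env x a) b)).
- by case: (sup_range01 evt_inhabited (fun x => ih a (cons_env x b))).
- by case: (inf_range01 evt_inhabited (fun x => ih a (cons_env x b))).
Qed.

(** A model need not attain an infimum, so witnesses are only approximate; hence the slack in
    [model_perturbation]. *)
Lemma ceval_CInfB_witness n m (Phi : cformula R L n m.+1) a b (e : R) :
  0 < e -> ceval (N := N) (CInfB Phi) a b = 0 -> exists x, ceval Phi a (cons_env x b) < e.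
Proof.
move=> e0 /= inf0.
have [] : exists2 r, range (fun x => ceval Phi a (cons_env x b)) r & r < 0 + e.
  rewrite -inf0; apply: inf_adherent => //; split.
    by case: evt_inhabited => x; exists (ceval Phi a (cons_env x b)), x.
  by exists 0 => _ [x _ <-]; case/andP: (ceval01 Phi a (cons_env x b)).
by rewrite add0r => _ [x _ <-]; exists x.
Qed.

Lemma ceval_CInfB_eq0 n m (Phi : cformula R L n m.+1) a b x :
  ceval (N := N) Phi a (cons_env x b) = 0 -> ceval (N := N) (CInfB Phi) a b = 0.
Proof.
move=> h; have [/andP[ge0 _] le] := inf_range01 evt_inhabited
  (fun x => ceval01 Phi a (cons_env x b)).
by apply/eqP; rewrite eq_le {2}/ceval /= ge0 andbT -h; exact: le.
Qed.

End Evaluation.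

(** Universal closure in continuous logic: truth is the value 0 and values are nonnegative, so a
    supremum vanishes exactly when every instance does. *)
Fixpoint sup_allB (R : realType) L n m : cformula R L n m -> cformula R L n 0 :=
  match m with
  | 0 => fun Phi => Phi
  | m'.+1 => fun Phi => sup_allB (CSupB Phi)
  end.

Fixpoint sup_allK (R : realType) L n m : cformula R L n m -> cformula R L 0 m :=
  match n with
  | 0 => fun Phi => Phi
  | n'.+1 => fun Phi => sup_allK (CSupK Phi)
  end.

Section Transfer.
Context {R : realType} {L : signature}.

Lemma sup_range_eq0 (X : Type) (f : X -> R) : inhabited X ->
  (forall x, 0 <= f x <= 1) -> sup (range f) = 0 <-> forall x, f x = 0.
Proof.
move=> X0 f01; have [/andP[ge0 _] le] := sup_range01 X0 f01; split=> [h x|h].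
  by apply/eqP; rewrite eq_le -{1}h le; case/andP: (f01 x).
apply/eqP; rewrite eq_le ge0 andbT; apply: ge_sup.
  by case: X0 => x; exists (f x), x.
by move=> _ [x _ <-]; rewrite h.
Qed.

Lemma sup_allB_eq0 (N : interpretation R L) n m (Phi : cformula R L n m) a :
  is_prestructure N ->
  ceval (N := N) (sup_allB Phi) a nil_env = 0 <-> forall b, ceval (N := N) Phi a b = 0.
Proof.
move=> hN; elim: m Phi => [|m ih] Phi /=.
  by split=> // h b; rewrite (nil_envE b).
rewrite ih; split=> [h b|h b] /=.
  rewrite (cons_env_eta b); move: (h (fun i => b (lift ord0 i))) => /=.
  by rewrite sup_range_eq0; [exact|exact: evt_inhabited|move=> x; exact: ceval01].
by rewrite sup_range_eq0; [|exact: evt_inhabited|move=> x; exact: ceval01].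
Qed.

Lemma sup_allK_eq0 (N : interpretation R L) n m (Phi : cformula R L n m) b :
  is_prestructure N ->
  ceval (N := N) (sup_allK Phi) nil_env b = 0 <-> forall a, ceval (N := N) Phi a b = 0.
Proof.
move=> hN; elim: n Phi => [|n ih] Phi /=.
  by split=> // h a; rewrite (nil_envE a).
rewrite ih; split=> [h a|h a] /=.
  rewrite (cons_env_eta a); move: (h (fun i => a (lift ord0 i))) => /=.
  by rewrite sup_range_eq0; [exact|exact: elt_inhabited|move=> x; exact: ceval01].
by rewrite sup_range_eq0; [|exact: elt_inhabited|move=> x; exact: ceval01].
Qed.

(** The universal closure of [Phi] is a sentence of T^R, so its truth in [N] makes every instance
    vanish. *)
Lemma transfer (T : theory L) (N : interpretation R L) n m (Phi : cformula R L n m) :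
  is_model_of_randomization T N ->
  (forall (M : structure L) (N0 : interpretation R L), nice_randomization M N0 ->
     forall a b, ceval (N := N0) Phi a b = 0) ->
  forall a b, ceval (N := N) Phi a b = 0.
Proof.
move=> [[hN _ _ _] hT] h.
suff : ctrue N (sup_allK (sup_allB Phi)).
  by rewrite /ctrue sup_allK_eq0 // => ha a; apply/sup_allB_eq0.
apply: hT => M N0 _ nN0.
have hN0 : is_prestructure N0 by case: nN0 => ? [? [? [? [? []]]]].
by rewrite /ctrue sup_allK_eq0 // => a; rewrite sup_allB_eq0 // => b; exact: (h M N0 nN0 a b).
Qed.

(** An identity of events is the vanishing of their distance, and the metric of a model separates
    points. *)
Lemma transfer_bterm (T : theory L) (N : interpretation R L) n m (s t : bterm L n m) :
  is_model_of_randomization T N ->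
  (forall (M : structure L) (N0 : interpretation R L) d (Omega : measurableType d)
     (P : probability Omega R) fK fB,
     nice_randomization_via (M := M) (N := N0) P fK fB ->
     forall a b, fB (bteval a b s) = fB (bteval a b t)) ->
  forall a b, bteval (N := N) a b s = bteval a b t.
Proof.
move=> hN h a b; have [_ _ _ sep] := hN.1; apply: sep.
apply: (transfer (Phi := CdB R s t) hN) => M N0 [d [W [P [fK [fB nv]]]]] a' b' /=.
rewrite (nice_fB_inj nv (h _ _ _ _ _ _ _ nv a' b')).
by case: (dB_pseudometric (nice_prestructure nv)).
Qed.

End Transfer.

(** * Finite-valued maps on atomless probability spaces *)

Section RealProbability.
Context {R : realType} {d : measure_display} {Om : measurableType d}.
Variable P : probability Om R.
Implicit Types A B C E F G : set Om.

Definition pr A : R := fine (P A).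

Lemma prE A : measurable A -> P A = (pr A)%:E.
Proof. by move=> mA; rewrite /pr fineK // fin_num_measure. Qed.

Lemma pr_ge0 A : 0 <= pr A.
Proof. by rewrite /pr fine_ge0. Qed.

Lemma pr0 : pr set0 = 0.
Proof. by rewrite /pr measure0. Qed.

Lemma le_pr A B : measurable A -> measurable B -> A `<=` B -> pr A <= pr B.
Proof.
by move=> mA mB AB; rewrite -lee_fin -!prE // le_measure // inE.
Qed.

Lemma pr_le1 A : measurable A -> pr A <= 1.
Proof.
move=> mA; apply: le_trans (_ : _ <= pr setT) _; first exact: le_pr.
by rewrite /pr probability_setT.
Qed.

Lemma prU A B : measurable A -> measurable B -> A `&` B = set0 ->
  pr (A `|` B) = pr A + pr B.
Proof.
move=> mA mB AB; apply: EFin_inj.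
rewrite EFinD -!prE //; last exact: measurableU.
by rewrite measureU.
Qed.

Lemma prD A B : measurable A -> measurable B -> B `<=` A ->
  pr (A `\` B) = pr A - pr B.
Proof.
move=> mA mB BA; have := prU mB (measurableD mA mB) (setDIK _ _).
by rewrite setDUK // => ->; rewrite addrC addKr.
Qed.

Hypothesis hP : atomless P.

(** Of the two pieces into which [E] splits, one has at most half of the mass. *)
Lemma atomless_half E : measurable E -> 0 < pr E ->
  exists F, [/\ measurable F, F `<=` E, 0 < pr F & pr F <= pr E / 2].
Proof.
move=> mE E0; have [|F [mF FE]] := hP mE; first by rewrite prE.
rewrite !prE // !lte_fin => F0 FltE.
have [le|lt] := leP (pr F) (pr E / 2); first by exists F.
exists (E `\` F); rewrite prD //; split; [exact: measurableD|exact: subDsetl|lra|lra].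
Qed.

Lemma atomless_small E (e : R) : measurable E -> 0 < pr E -> 0 < e ->
  exists F, [/\ measurable F, F `<=` E, 0 < pr F & pr F <= e].
Proof.
move=> mE E0 e0.
(* Any [n] above [pr E / e] works, because [n < 2 ^ n]. *)
have [n hn] : exists n, pr E / 2 ^+ n <= e.
  exists (Num.bound (pr E / e)); rewrite ler_pdivrMr ?exprn_gt0 //.
  rewrite mulrC -ler_pdivrMr //; apply/ltW/(lt_trans (archi_boundP _)).
    by rewrite divr_ge0 ?ltW.
  by rewrite -natrX ltr_nat ltn_expl.
suff [F [mF FE F0 Fn]] : exists F, [/\ measurable F, F `<=` E, 0 < pr F & pr F <= pr E / 2 ^+ n].
  by exists F; split=> //; exact: le_trans Fn hn.
elim: n {hn} => [|n [F [mF FE F0 Fn]]]; first by exists E; rewrite expr0 divr1; split.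
have [G [mG GF G0 hG]] := atomless_half mF F0.
exists G; split=> //; first exact: subset_trans GF FE.
by rewrite (le_trans hG) // exprSr invfM mulrA ler_pM2r ?invr_gt0.
Qed.

(* Sierpinski: an increasing sequence that at each step adds at least half of
   what can be added exhausts the prescribed mass. *)
Lemma atomless_intermediate E (c : R) : measurable E -> 0 <= c <= pr E ->
  exists F, [/\ measurable F, F `<=` E & pr F = c].
Proof.
move=> mE /andP[c0 cE].
pose adm F := [/\ measurable F, F `<=` E & pr F <= c].
have step (F : {F | adm F}) : exists G : {F | adm F}, sval F `<=` sval G /\
    forall H, adm H -> sval F `<=` H -> pr H - pr (sval F) <= 2 * (pr (sval G) - pr (sval F)).
  case: F => F [mF FE Fc] /=.
  pose S := [set r | exists H, [/\ adm H, F `<=` H & pr H = r]].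
  have hS : has_sup S.
    split; first by exists (pr F), F; split.
    by exists c => _ [H [[_ _ ?] _ <-]].
  have le_sup H : adm H -> F `<=` H -> pr H <= sup S.
    by move=> aH FH; apply: ub_le_sup; [exact: hS.2|exists H].
  (* Half of the supremal gain can be secured when that gain is positive; otherwise [F] itself
     serves. *)
  have [ltF|leF] := ltP (pr F) (sup S); last first.
    exists (exist _ F (And3 mF FE Fc)); split=> //= H aH FH.
    by have := le_sup _ aH FH; lra.
  have [|_ [G [aG FG <-]] hG] := @sup_adherent _ S ((sup S - pr F) / 2) _ hS.
    by rewrite divr_gt0 // subr_gt0.
  exists (exist _ G aG); split=> //= H aH FH.
  by have := le_sup _ aH FH; lra.
have adm0 : adm set0 by split=> //; rewrite pr0.
have [f hf] := choice step.
pose F n := iter n f (exist _ set0 adm0).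
have aF n : adm (sval (F n)) by exact: svalP.
have mF n : measurable (sval (F n)) by case: (aF n).
pose U := \bigcup_n sval (F n).
have mU : measurable U by exact: bigcupT_measurable.
have UE : U `<=` E by apply: bigcup_sub => n _; case: (aF n).
have Fmono : {homo (fun n => sval (F n)) : n m / (n <= m)%N >-> (n <= m)%O}.
  apply: homo_leq => [A|B A C|n]; [exact: lexx|exact: le_trans|].
  by apply/subsetPset; case: (hf (F n)).
have Uc : pr U <= c.
  have cvgF := nondecreasing_cvg_mu (mu := P) mF mU Fmono.
  rewrite -lee_fin -prE // -(cvg_lim _ cvgF) //.
  apply: lime_le; first by apply/cvg_ex; exists (P U).
  by apply: nearW => n /=; rewrite prE // lee_fin; case: (aF n).
exists U; split=> //; apply/eqP; rewrite eq_le Uc /= leNgt; apply/negP => Ultc.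
(* If mass is missing, a small non-null [G] outside [U] can be added at every stage. Each stage then
   gains at least [pr G / 2], which is impossible in a finite measure. *)
have [|||G [mG GE G0 Gc]] := @atomless_small (E `\` U) (c - pr U).
- exact: measurableD.
- by rewrite prD // subr_gt0 (lt_le_trans Ultc).
- by rewrite subr_gt0.
have GU : U `&` G = set0.
  by apply/seteqP; split=> // w [Uw /GE[]].
have prUG : pr (U `|` G) = pr U + pr G by rewrite prU.
have aUG : adm (U `|` G).
  split; [exact: measurableU| |by rewrite prUG; lra].
  by rewrite subUset; split=> // w /GE[].
have incr n : pr G <= 2 * (pr (sval (F n.+1)) - pr (sval (F n))).
  have [_ /(_ _ aUG)] := hf (F n).
  rewrite prUG -/(F n.+1) => h; apply: le_trans (h _); last first.
    by move=> w Fw; left; exists n.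
  have : pr (sval (F n)) <= pr U by apply: le_pr => // w Fw; exists n.
  lra.
have bound n : n%:R * pr G <= 2 * pr (sval (F n)).
  elim: n => [|n ih]; first by rewrite mul0r pr0 mulr0.
  by rewrite -natr1 mulrDl mul1r; have := incr n; lra.
have h2 n : n%:R * pr G <= 2.
  by apply: le_trans (bound n) _; have := pr_le1 (mF n); lra.
have := archi_boundP (ltW (divr_gt0 (ltr0n _ 2) G0)); rewrite ltr_pdivrMr // => h.
by have := h2 (Num.bound (2 / pr G)); lra.
Qed.
End RealProbability.

Section FiniteMaps.
Context {R : realType} {d : measure_display} {Om : measurableType d}.
Variable P : probability Om R.
Local Notation pr := (pr P).

Definition fin_measurable (X : finType) (f : Om -> X) :=
  forall x, measurable [set w | f w = x].

(** Total variation distance of laws, stated through all subsets of [X] rather than its points, so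
    that it passes to images without loss ([tvclose_comp]). *)
Definition tvclose (X : finType) (e : R) (f f' : Om -> X) :=
  forall h : pred X, `|pr [set w | h (f w)] - pr [set w | h (f' w)]| <= e.

Lemma measurable_eq_cst (Y : eqType) (y y' : Y) : measurable [set w : Om | y = y'].
Proof.
have [->|yy'] := eqVneq y y'.
  by rewrite (_ : [set _ | _] = setT) //; apply/seteqP.
rewrite (_ : [set _ | _] = set0) //.
by apply/seteqP; split=> // z /= /eqP; rewrite (negbTE yy').
Qed.

Lemma fin_measurable_pred (X : finType) (f : Om -> X) (h : pred X) :
  fin_measurable f -> measurable [set w | h (f w)].
Proof.
move=> mf; rewrite (_ : [set _ | _] = \big[setU/set0]_(x in h) [set w | f w = x]).
  exact: bigsetU_measurable.
rewrite -bigcup_pred; apply/seteqP; split=> [w hw|w [x hx] /= -> //].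
by exists (f w).
Qed.

Lemma fin_measurable_comp (X Y : finType) (f : Om -> X) (c : X -> Y) :
  fin_measurable f -> fin_measurable (fun w => c (f w)).
Proof.
move=> mf y.
by have := fin_measurable_pred (fun x => c x == y) mf; congr measurable;
  apply/seteqP; split=> w /= /eqP.
Qed.

Lemma fin_measurable_pair (X Y : finType) (f : Om -> X) (g : Om -> Y) :
  fin_measurable f -> fin_measurable g -> fin_measurable (fun w => (f w, g w)).
Proof.
move=> mf mg [x y]; rewrite (_ : [set _ | _] = [set w | f w = x] `&` [set w | g w = y]).
  exact: measurableI.
by apply/seteqP; split=> w /= [-> ->].
Qed.

Lemma pr_fin_map (X : finType) (f : Om -> X) (h : pred X) A :
  measurable A -> fin_measurable f ->
  pr (A `&` [set w | h (f w)]) = \sum_(x | h x) pr (A `&` [set w | f w = x]).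
Proof.
move=> mA mf; rewrite -big_enum /=.
rewrite (_ : [set w | h (f w)] = [set w | f w \in enum h]); last first.
  by apply/seteqP; split=> w /=; rewrite mem_enum.
elim: (enum h) (enum_uniq h) => [|x s ih] /=.
  by rewrite big_nil (_ : [set _ | _] = set0) ?setI0 ?pr0 // -subset0.
move=> /andP[xs us]; rewrite big_cons -ih // -prU.
- congr (pr _); rewrite -setIUr; congr (_ `&` _).
  by apply/seteqP; split=> w /=; rewrite inE => /predU1P.
- exact: measurableI.
- exact/measurableI/(fin_measurable_pred (mem s)).
- by apply/seteqP; split=> // w /= [[_ fx] [_ fs]]; move: xs; rewrite -fx fs.
Qed.

Lemma tvclose_sym (X : finType) (e : R) (f f' : Om -> X) :
  tvclose e f f' -> tvclose e f' f.
Proof. by move=> h p; rewrite distrC. Qed.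

Lemma tvclose_le (X : finType) (e e' : R) (f f' : Om -> X) :
  e <= e' -> tvclose e f f' -> tvclose e' f f'.
Proof. by move=> ee' h p; exact: le_trans ee'. Qed.

Lemma tvclose_comp (X Y : finType) (e : R) (f f' : Om -> X) (c : X -> Y) :
  tvclose e f f' -> tvclose e (fun w => c (f w)) (fun w => c (f' w)).
Proof. by move=> h p; exact: (h (fun x => p (c x))). Qed.

Lemma tvclose_cells (X : finType) (e e' : R) (f f' : Om -> X) :
  fin_measurable f -> fin_measurable f' -> 0 <= e -> #|X|%:R * e <= e' ->
  (forall x, `|pr [set w | f w = x] - pr [set w | f' w = x]| <= e) ->
  tvclose e' f f'.
Proof.
move=> mf mf' e0 ee' h p; apply: le_trans ee'.
rewrite -[X in pr X]setTI -[X in _ - pr X]setTI !pr_fin_map // -sumrB.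
apply: le_trans (ler_norm_sum _ _ _) _.
apply: (@le_trans _ _ (\sum_(x | p x) e)).
  by apply: ler_sum => x _; rewrite !setTI.
by rewrite sumr_const -[leLHS]mulr_natl; apply: ler_wpM2r; rewrite // ler_nat max_card.
Qed.

Hypothesis hP : atomless P.

(** Cut off mass [w y] from [C] by [atomless_intermediate] and split the remainder by induction. *)
Lemma atomless_split (Y : eqType) (w : Y -> R) (s : seq Y) C :
  measurable C -> (forall y, y \in s -> 0 <= w y) -> s != [::] -> uniq s ->
  \sum_(y <- s) w y = pr C ->
  exists g : Om -> Y, [/\ forall y, measurable [set z | g z = y],
    forall z, g z \in s & forall y, y \in s -> pr (C `&` [set z | g z = y]) = w y].
Proof.
elim: s C => // y s ih C mC w0 _ /andP[ys us]; rewrite big_cons.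
(* The last value is taken on the whole space, so that [g] stays in [s] off [C] as well. *)
have [->|s0] := eqVneq s [::].
  rewrite big_nil addr0 => wy; exists (fun=> y); split=> [y'|z|y'].
  - exact: measurable_eq_cst.
  - by rewrite inE.
  - by rewrite inE => /eqP ->; rewrite (_ : [set _ | _] = setT) ?setIT //; apply/seteqP.
have ws0 : 0 <= \sum_(i <- s) w i.
  by rewrite big_seq sumr_ge0 // => i si; rewrite w0 // inE si orbT.
have wy0 : 0 <= w y by rewrite w0 // inE eqxx.
move=> wC; have [|B [mB BC By]] := @atomless_intermediate _ _ _ P hP C (w y) mC.
  by rewrite wy0 -wC lerDl.
have [|||||g [mg gs hg]] := ih (C `\` B) => //.
- exact: measurableD.
- by move=> z zs; rewrite w0 // inE zs orbT.
- by rewrite prD // By -wC; lra.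
exists (fun z => if `[< B z >] then y else g z); split=> [y'|z|y'].
- rewrite (_ : [set _ | _] = (B `&` [set z | y = y']) `|` ([set z | g z = y'] `\` B)).
    apply: measurableU; last exact: measurableD.
    exact/measurableI/measurable_eq_cst.
  apply/seteqP; split=> z /=; case: asboolP => Bz.
  + by move=> ->; left.
  + by move=> ->; right.
  + by case=> [[]|[]].
  + by case=> [[]|[]].
- by case: ifP => _; rewrite inE ?eqxx // gs orbT.
- rewrite inE => /predU1P[->|y's].
    rewrite -By; congr (pr _); apply/seteqP; split=> [z [Cz]|z Bz] /=.
      by case: asboolP => // _ gz; move: ys; rewrite -gz gs.
    by split; [exact: BC|case: asboolP].
  rewrite -hg //; congr (pr _); apply/seteqP; split=> [z [Cz]|z [[Cz nB] gz]] /=.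
    by case: asboolP => // _ yy'; move: ys; rewrite yy' y's.
  by split=> //; case: asboolP.
Qed.

(** The values of [g] on [C] are redistributed over [C'] with all weights scaled by [pr C' / pr C].
    The predicate [S] records the permitted values, which restricts [g'] to values that can be
    realized. *)
Lemma transport_cell (Y : finType) (S : pred Y) C C' (g : Om -> Y) (e : R) :
  measurable C -> measurable C' -> fin_measurable g ->
  (forall w, C w -> S (g w)) -> (forall w, C' w -> exists y, S y) ->
  `|pr C - pr C'| <= e ->
  exists g' : Om -> Y, [/\ fin_measurable g', forall w, C' w -> S (g' w) &
    forall y, `|pr (C `&` [set w | g w = y]) - pr (C' `&` [set w | g' w = y])| <= e].
Proof.
move=> mC mC' mg SC SC' CC'.
have [y0 Sy0|S0] := pickP S; last first.
  have C0 : C = set0 by apply/seteqP; split=> // w /SC; rewrite S0.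
  have C'0 : C' = set0 by apply/seteqP; split=> // w /SC' [y]; rewrite S0.
  exists g; split=> // [w|y]; first by rewrite C'0.
  by rewrite C0 C'0 !set0I subrr normr0 (le_trans (normr_ge0 _) CC').
have mgy A y (g' : Om -> Y) : measurable A -> fin_measurable g' ->
    measurable (A `&` [set w | g' w = y]) by move=> mA mg'; exact: measurableI.
(* A null [C] has no proportions to copy; then [C'] has measure at most [e] and any permitted
   constant will do. *)
have [C0|C0] := eqVneq (pr C) 0.
  have my0 : fin_measurable (fun _ : Om => y0) by move=> y; exact: measurable_eq_cst.
  exists (fun=> y0); split=> // y.
  have h1 := le_pr P (mgy _ y _ mC mg) mC (@subIsetl _ _ _).
  have h2 := le_pr P (mgy _ y _ mC' my0) mC' (@subIsetl _ _ _).
  have := pr_ge0 P (C `&` [set w | g w = y]).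
  have := pr_ge0 P (C' `&` [set w | y0 = y]).
  move: CC'; rewrite !ler_norml => /andP[]; lra.
have Cpos : 0 < pr C by rewrite lt_neqAle eq_sym C0 pr_ge0.
pose w y := pr (C `&` [set z | g z = y]) * (pr C' / pr C).
have sum_w : \sum_(y <- enum S) w y = pr C'.
  rewrite big_enum /= -mulr_suml -(pr_fin_map S mC mg).
  rewrite (_ : C `&` _ = C); first by rewrite mulrC divfK.
  by apply/seteqP; split=> [z []|z Cz] //; split=> //; exact: SC.
have [||g' [mg' g'S hg']] := atomless_split (w := w) mC' _ _ (enum_uniq S) sum_w.
- by move=> y _; rewrite mulr_ge0 ?divr_ge0 ?pr_ge0.
- by apply/eqP => E; have : y0 \in enum S by [rewrite mem_enum]; rewrite E.
exists g'; split=> [//|z _|y]; first by have := g'S z; rewrite mem_enum.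
have [Sy|nSy] := boolP (S y); last first.
  have C0y : C `&` [set z | g z = y] = set0.
    by apply/seteqP; split=> // z [Cz /= gz]; move: nSy; rewrite -gz SC.
  have C'0y : C' `&` [set z | g' z = y] = set0.
    apply/seteqP; split=> // z [_ /= gz]; move: nSy; rewrite -gz.
    by have := g'S z; rewrite mem_enum => /[dup] h; rewrite -topredE /= => ->.
  by rewrite C0y C'0y subrr normr0 (le_trans (normr_ge0 _) CC').
rewrite hg' ?mem_enum // /w.
set p := pr (C `&` _); have p0 : 0 <= p by exact: pr_ge0.
have pC : p <= pr C by apply: le_pr; [exact: mgy|exact: mC|exact: subIsetl].
(* The error is the fraction [p / pr C], at most 1, of the difference of the masses. *)
have -> : p - p * (pr C' / pr C) = p / pr C * (pr C - pr C') by field.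
rewrite normrM ger0_norm ?divr_ge0 ?pr_ge0 // (le_trans _ CC') // ler_piMl //.
by rewrite ler_pdivrMr // mul1r.
Qed.

(* In each cell of [f'] the values of [g'] are distributed proportionally to
   those of [g] in the corresponding cell of [f]. *)
Lemma transport (X Y : finType) (S : X -> pred Y) (f f' : Om -> X) (g : Om -> Y) (e : R) :
  fin_measurable f -> fin_measurable f' -> fin_measurable g ->
  (forall w, S (f w) (g w)) -> (forall w, exists y, S (f' w) y) ->
  tvclose e f f' ->
  exists g' : Om -> Y, [/\ fin_measurable g', forall w, S (f' w) (g' w) &
    tvclose (#|{: X * Y}|%:R * e) (fun w => (f w, g w)) (fun w => (f' w, g' w))].
Proof.
move=> mf mf' mg Sfg Sf' ff'.
have e0 : 0 <= e by exact: le_trans (normr_ge0 _) (ff' xpred0).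
have cells x : `|pr [set w | f w = x] - pr [set w | f' w = x]| <= e.
  have := ff' (pred1 x); congr (`|pr _ - pr _| <= e).
    by apply/seteqP; split=> w /= /eqP.
  by apply/seteqP; split=> w /= /eqP.
have /choice[G hG] x : exists g' : Om -> Y, [/\ fin_measurable g',
    forall w, [set w | f' w = x] w -> S x (g' w) &
    forall y, `|pr ([set w | f w = x] `&` [set w | g w = y]) -
                pr ([set w | f' w = x] `&` [set w | g' w = y])| <= e].
  by apply: transport_cell => // w /= <- //; exact: Sf'.
have eqcell x y : [set w | (f' w, G (f' w) w) = (x, y)] =
    [set w | f' w = x] `&` [set w | G x w = y].
  apply/seteqP; split=> w /=; first by move=> [<- <-].
  by move=> [<- ->].
have mfG : fin_measurable (fun w => (f' w, G (f' w) w)).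
  by move=> [x y]; rewrite eqcell; apply: measurableI => //; case: (hG x).
exists (fun w => G (f' w) w); split.
- exact: (fin_measurable_comp snd mfG).
- by move=> w; case: (hG (f' w)) => _ + _; apply.
- apply: (tvclose_cells (e := e)) => //; first exact: fin_measurable_pair.
  move=> [x y]; rewrite eqcell; have [_ _ /(_ y)] := hG x.
  congr (`|pr _ - _| <= e); apply/seteqP; split=> w /=; first by move=> [-> ->].
  by move=> [-> ->].
Qed.
End FiniteMaps.

(** * Quantifier elimination in nice randomizations *)

Section UniformContinuity.
Context {R : realType}.

Lemma unit_cube_compact n : compact (unit_cube R n).
Proof.
rewrite (_ : unit_cube R n = [set v | forall i, `[0, 1]%classic (v ord0 i)]).
  by apply: (@rV_compact R n (fun=> `[0, 1]%classic)) => i; exact: segment_compact.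
by apply/seteqP; split=> v /= hv i; have := hv i; rewrite in_itv.
Qed.

(** Heine's theorem on the compact cube. *)
Lemma connective_unif_continuous n (u : connective R n) (e : R) : 0 < e ->
  exists2 dl : R, 0 < dl & forall v w, unit_cube R n v -> unit_cube R n w ->
    (forall i, `|v ord0 i - w ord0 i| < dl) -> `|u v - u w| < e.
Proof.
move=> e0.
have /compact_near_coveringP cpt := @unit_cube_compact n.
pose Q (dl : R) (v : 'rV[R]_n) := unit_cube R n v -> forall w, unit_cube R n w ->
  ball v dl w -> `|u v - u w| < e.
have : \forall dl \near 0^'+, unit_cube R n `<=` Q dl.
  apply: cpt => v hv.
  have /subspace_continuousP/(_ v hv)/cvgrPdist_lt/(_ (e / 2)) := @conn_continuous R n u.
  rewrite divr_gt0 // => /(_ isT)/nbhs_ballP[r /= r0 hr].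
  (* For [x] within [r / 2] of [v] and [w] within [dl] of [x], both points lie in the ball of radius
     [r] around [v], where [u] is within [e / 2] of [u v]. *)
  exists (ball v (r / 2), [set dl | dl < r / 2]) => /=.
    split; first by apply: nbhsx_ballx; rewrite divr_gt0.
    by apply: nbhs_right_lt; rewrite divr_gt0.
  move=> [x dl] /= [vx dlr] hx w hw xw.
  have near_v y : unit_cube R n y -> ball v r y -> `|u v - u y| < e / 2.
    by move=> hy vy; exact: hr.
  have -> : u x - u w = (u v - u w) - (u v - u x) by ring.
  rewrite [e]splitr (le_lt_trans (ler_normB _ _)) // ltrD // near_v //.
    by rewrite [r]splitr; apply: ball_triangle vx _; exact: le_ball (ltW dlr) _ xw.
  by apply: le_ball vx; rewrite ler_pdivrMr // ler_pMr // ler1n.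
move=> [r /= r0 hr]; exists (r / 2); first by rewrite divr_gt0.
move=> v w hv hw vw; apply: (hr (r / 2)) => //=.
- by rewrite sub0r normrN gtr0_norm ?divr_gt0 // ltr_pdivrMr // ltr_pMr // ltr1n.
- by rewrite divr_gt0.
- by split=> [|i j]; rewrite ?divr_gt0 ?(ord1 i) //; exact: vw.
Qed.
End UniformContinuity.

Section NiceRandomization.
Context {R : realType} {L : signature} {M : structure L} {N : interpretation R L}
  {d : measure_display} {Om : measurableType d} {P : probability Om R}.
Context {fK : elt N -> Om -> M} {fB : evt N -> set Om}.
Hypothesis nv : nice_randomization_via P fK fB.
Local Notation pr := (pr P).

Lemma nice_measurable b : measurable (fB b).
Proof. by rewrite -(nice_fB_range nv); exists b. Qed.

Lemma nice_measurable_evt E : measurable E -> exists b, fB b = E.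
Proof. by rewrite -(nice_fB_range nv) => -[b _ <-]; exists b. Qed.

Lemma nice_mu_pr b : mu b = pr (fB b).
Proof. by apply: EFin_inj; rewrite (nice_mu nv) prE //; exact: nice_measurable. Qed.

Lemma nice_dB_pr b c : dB b c = pr (fB b `+` fB c).
Proof.
apply: EFin_inj; rewrite (nice_dB nv) prE //.
by apply: measurableU; apply: measurableD; exact: nice_measurable.
Qed.

(** The cell containing [w], as a map into a finite type: its law is the joint law of the events
    [[[F i(a)]]] and [b j]. *)
Definition pattern n m (I : finType) (F : I -> formula L n) (a : 'I_n -> elt N)
    (b : 'I_m -> evt N) (w : Om) : {ffun I -> bool} * {ffun 'I_m -> bool} :=
  (sat_pattern F (fun i => fK (a i) w), [ffun j => `[< fB (b j) w >]]).

Lemma fin_measurable_ffun (I : finType) (h : Om -> {ffun I -> bool}) :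
  (forall i, measurable [set w | h w i]) -> fin_measurable h.
Proof.
move=> mh p.
rewrite (_ : [set _ | _] = \bigcap_(i in [set: I]) [set w | h w i = p i]).
  apply: fin_bigcap_measurable => // i _; case: (p i); first exact: mh.
  rewrite (_ : [set _ | _] = ~` [set w | h w i]); first exact: measurableC.
  by apply/seteqP; split=> w /=; [move=> ->|move/negP/negbTE].
apply/seteqP; split=> [w /= <- //|w hw].
by apply/ffunP => i; exact: hw.
Qed.

Lemma fin_measurable_sat_pattern n (I : finType) (F : I -> formula L n) (a : 'I_n -> elt N) :
  fin_measurable (fun w => sat_pattern F (fun i => fK (a i) w)).
Proof.
apply: fin_measurable_ffun => i.
rewrite (_ : [set _ | _] = fB (ev (F i) a)); first exact: nice_measurable.
by rewrite (nice_ev nv); apply/seteqP; split=> w /=; rewrite ffunE => /asboolP.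
Qed.

Lemma fin_measurable_evt b : fin_measurable (fun w => `[< fB b w >]).
Proof.
move=> c; have := nice_measurable b; case: c => mb.
  by rewrite (_ : [set _ | _] = fB b) //; apply/seteqP; split=> w /= /asboolP.
rewrite (_ : [set _ | _] = ~` fB b); first exact: measurableC.
by apply/seteqP; split=> w /= => [/negbT/asboolPn|/asboolPn/negbTE].
Qed.

Lemma fin_measurable_pattern n m (I : finType) (F : I -> formula L n) a (b : 'I_m -> evt N) :
  fin_measurable (pattern F a b).
Proof.
apply: fin_measurable_pair; first exact: fin_measurable_sat_pattern.
apply: fin_measurable_ffun => i.
rewrite (_ : [set _ | _] = fB (b i)); first exact: nice_measurable.
by apply/seteqP; split=> w /=; rewrite ffunE => /asboolP.
Qed.

(* An event is some [[psi(c)]], so the formula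
   (psi /\ u = x_0) \/ (~ psi /\ u = x_1) has a witness u. *)
Lemma nice_glue (x0 x1 : elt N) (e : evt N) :
  exists z, forall w, fK z w = if `[< fB e w >] then fK x0 w else fK x1 w.
Proof.
have [n [psi [c ->]]] := nice_ev_surj nv e.
pose psi' : formula L n.+3 :=
  rename_formula psi (fun i => lift ord0 (lift ord0 (lift ord0 i))).
pose theta : formula L n.+3 :=
  Or (And psi' (Eq (Var ord0) (Var (lift ord0 ord0))))
     (And (Not psi') (Eq (Var ord0) (Var (lift ord0 (lift ord0 ord0))))).
have [z hz] := nice_witness nv theta (cons_env x0 (cons_env x1 c)).
exists z => w.
have satE u : sat theta (cons_env u (cons_env (fK x0 w) (cons_env (fK x1 w)
      (fun i => fK (c i) w)))) <->
    u = if `[< fB (ev psi c) w >] then fK x0 w else fK x1 w.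
  rewrite /theta /psi' /= !sat_rename !(cons_env_lift, cons_env0) (nice_ev nv) /=.
  rewrite (_ : (fun i => _) = (fun i => fK (c i) w)); last first.
    by apply/funext => i; rewrite !cons_env_lift.
  by case: asboolP => hw; split; tauto.
apply/satE.
have : fB (ev (Ex theta) (cons_env x0 (cons_env x1 c))) w.
  rewrite (nice_ev nv) /=; eexists; rewrite !(cons_env_comp (fun x => fK x w)).
  by apply/satE; reflexivity.
by rewrite -hz (nice_ev nv) => h; move: h; rewrite /mkset !(cons_env_comp (fun x => fK x w)).
Qed.

Lemma nice_glue_fin (Y : finType) (x : Y -> elt N) (g : Om -> Y) : fin_measurable g ->
  exists z, forall w, fK z w = fK (x (g w)) w.
Proof.
move=> mg.
suff [z hz] : exists z, forall w, g w \in enum Y -> fK z w = fK (x (g w)) w.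
  by exists z => w; apply: hz; rewrite mem_enum.
elim: (enum Y) => [|y s [z hz]].
  by case: (elt_inhabited (nice_prestructure nv)) => z; exists z.
have [e he] := nice_measurable_evt (mg y).
have [z' hz'] := nice_glue (x y) z e.
exists z' => w; rewrite hz' he; case: asboolP => [/= -> //|ny].
by rewrite inE => /predU1P[//|]; exact: hz.
Qed.

(* The pattern of [a] for the formulas [Ex (pattern_formula F y)] tells which
   patterns [y] of [F] are realized at a point by some value of the new variable. *)
Lemma pattern_extend_elt n m (I : finType) (F : I -> formula L n.+1) a a'
    (b b' : 'I_m -> evt N) (e e' : R) (x : elt N) :
  #|{: ({ffun {ffun I -> bool} -> bool} * {ffun 'I_m -> bool}) * {ffun I -> bool}}|%:R * e <= e' ->
  tvclose P e (pattern (fun y => Ex (pattern_formula F y)) a b)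
    (pattern (fun y => Ex (pattern_formula F y)) a' b') ->
  exists x', tvclose P e' (pattern F (cons_env x a) b) (pattern F (cons_env x' a') b').
Proof.
move=> ee' cl.
pose F' y := Ex (pattern_formula F y).
have [||g' [mg' Sg' cl']] := transport
    (S := fun (p : {ffun {ffun I -> bool} -> bool} * {ffun 'I_m -> bool}) y => p.1 y)
    (nice_atomless nv) (fin_measurable_pattern F' a b) (fin_measurable_pattern F' a' b')
   (fin_measurable_sat_pattern F (cons_env x a)) _ _ cl.
- move=> w; rewrite ffunE; apply/asboolP; exists (fK x w).
  by apply/sat_pattern_formula; rewrite (cons_env_comp (fun x => fK x w)).
- move=> w; have [x0] := carrier_inhabited M.
  exists (sat_pattern F (cons_env x0 (fun i => fK (a' i) w))).
  by rewrite ffunE; apply/asboolP; exists x0; apply/sat_pattern_formula.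
(* One witness for each pattern, all over [a']; gluing them along [g'] gives the required random
   element. *)
have [xw hxw] := choice (fun y => nice_witness nv (pattern_formula F y) a').
have [x' hx'] := nice_glue_fin xw mg'.
exists x'.
have x'g' w : sat_pattern F (fun i => fK (cons_env x' a' i) w) = g' w.
  apply/sat_pattern_formula; rewrite (cons_env_comp (fun x => fK x w)) hx'.
  have := Sg' w; rewrite ffunE => /asboolP.
  have : fB (ev (Ex (pattern_formula F (g' w))) a') w = fB (ev (pattern_formula F (g' w))
      (cons_env (xw (g' w)) a')) w by rewrite hxw.
  by rewrite !(nice_ev nv) /mkset (cons_env_comp (fun x => fK x w)) => ->.
apply: tvclose_le ee' _.
(* Forget which patterns were realizable; keep the pattern of the new element and the old events. *)
pose c (p : ({ffun {ffun I -> bool} -> bool} * {ffun 'I_m -> bool}) * {ffun I -> bool}) :=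
  (p.2, p.1.2).
have -> : pattern F (cons_env x' a') b' = (fun w => c (pattern F' a' b' w, g' w)).
  by apply/funext => w; rewrite /pattern x'g'.
exact: (tvclose_comp c cl').
Qed.

(** An event may cut a cell arbitrarily. There is thus no realizability condition, and the same
    formulas [F] serve before and after the extension. *)
Lemma pattern_extend_evt n m (I : finType) (F : I -> formula L n) a a'
    (b b' : 'I_m -> evt N) (e e' : R) (x : evt N) :
  #|{: ({ffun I -> bool} * {ffun 'I_m -> bool}) * bool}|%:R * e <= e' ->
  tvclose P e (pattern F a b) (pattern F a' b') ->
  exists x', tvclose P e' (pattern F a (cons_env x b)) (pattern F a' (cons_env x' b')).
Proof.
move=> ee' cl.
have [||g' [mg' _ cl']] := transport (S := fun _ _ => true) (nice_atomless nv)
   (fin_measurable_pattern F a b) (fin_measurable_pattern F a' b')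
   (fin_measurable_evt x) _ _ cl => //.
  by move=> w; exists true.
have [x' hx'] := nice_measurable_evt (mg' true).
exists x'; apply: tvclose_le ee' _.
pose c (p : ({ffun I -> bool} * {ffun 'I_m -> bool}) * bool) :
    {ffun I -> bool} * {ffun 'I_m.+1 -> bool} :=
  (p.1.1, [ffun j => cons_env p.2 p.1.2 j]).
have patE y (a0 : 'I_n -> elt N) (b0 : 'I_m -> evt N) :
    pattern F a0 (cons_env y b0) = (fun w => c (pattern F a0 b0 w, `[< fB y w >])).
  apply/funext => w; congr (_, _); apply/ffunP => j.
  rewrite !ffunE /=.
  have /= -> := congr1 (fun f => f j) (cons_env_comp (fun c => `[< fB c w >]) y b0).
  by congr (cons_env _ _ j); apply/funext => i; rewrite ffunE.
rewrite !patE (_ : (fun w => c (pattern F a' b' w, _)) = (fun w => c (pattern F a' b' w, g' w))).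
  exact: (tvclose_comp c cl').
by apply/funext => w; rewrite hx' asboolb.
Qed.

End NiceRandomization.
Arguments pattern {R L M N d Om} fK fB {n m I} F a b w.

Section QuantifierElimination.
Context {R : realType} {L : signature}.

(* Approximate quantifier elimination, uniform in the nice randomization: up to
   [e], [Phi] depends only on the joint law of finitely many events. *)
Definition qf_determined n m (Phi : cformula R L n m) := forall e : R, 0 < e ->
  exists (I : finType) (F : I -> formula L n) (dl : R), 0 < dl /\
    forall (M : structure L) (N : interpretation R L) d (Om : measurableType d)
      (P : probability Om R) (fK : elt N -> Om -> M) (fB : evt N -> set Om),
      nice_randomization_via P fK fB -> forall a a' b b',
      tvclose P dl (pattern fK fB F a b) (pattern fK fB F a' b') ->
      `|ceval (N := N) Phi a b - ceval Phi a' b'| <= e.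

(** The exact counterpart of [qf_determined] for terms: the event is a union of cells. *)
Definition pattern_determined n m (t : bterm L n m) :=
  exists (I : finType) (F : I -> formula L n)
    (h : pred ({ffun I -> bool} * {ffun 'I_m -> bool})),
    forall (M : structure L) (N : interpretation R L) d (Om : measurableType d)
      (P : probability Om R) (fK : elt N -> Om -> M) (fB : evt N -> set Om),
      nice_randomization_via P fK fB -> forall a b,
      fB (bteval a b t) = [set w | h (pattern fK fB F a b w)].

(** Both families of formulas are merged into one indexed by the sum type. Negation is later treated
    as an operation that ignores its second argument. *)
Lemma pattern_determined_op n m (op : bool -> bool -> bool) (s t u : bterm L n m) :
  (forall (M : structure L) (N : interpretation R L) d (Om : measurableType d)
     (P : probability Om R) (fK : elt N -> Om -> M) (fB : evt N -> set Om),
     nice_randomization_via P fK fB -> forall a b,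
     fB (bteval a b u) =
     [set w | op `[< fB (bteval a b s) w >] `[< fB (bteval a b t) w >]]) ->
  pattern_determined s -> pattern_determined t -> pattern_determined u.
Proof.
move=> uE [I [F [h hF]]] [J [G [k kG]]].
exists (I + J)%type, (fun s => match s with inl i => F i | inr j => G j end).
exists (fun p : {ffun (I + J)%type -> bool} * {ffun 'I_m -> bool} =>
  op (h ([ffun i => p.1 (inl i)], p.2)) (k ([ffun j => p.1 (inr j)], p.2))).
move=> M N d Om P fK fB nv a b.
rewrite (uE _ _ _ _ _ _ _ nv) (hF _ _ _ _ _ _ _ nv) (kG _ _ _ _ _ _ _ nv).
apply/eq_set => w; rewrite /= !asboolb; congr (is_true (op (h (_, _)) (k (_, _)))).
  by apply/ffunP => i; rewrite !ffunE.
by apply/ffunP => i; rewrite !ffunE.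
Qed.

Lemma bterm_pattern n m (t : bterm L n m) : pattern_determined t.
Proof.
elim: t => [i|k phi xs| | |s ihs t iht|s ihs t iht|t iht].
- exists void, (fun=> true_formula L n),
    (fun p : {ffun void -> bool} * {ffun 'I_m -> bool} => p.2 i) => M N d Om P fK fB nv a b.
  by apply/seteqP; split=> w /=; rewrite ffunE => /asboolP.
- exists unit, (fun=> rename_formula phi xs),
    (fun p : {ffun unit -> bool} * {ffun 'I_m -> bool} => p.1 tt) => M N d Om P fK fB nv a b.
  by rewrite /= (nice_ev nv); apply/seteqP; split=> w /=; rewrite ffunE sat_rename => /asboolP.
- exists void, (fun=> true_formula L n), xpredT => M N d Om P fK fB nv a b.
  by rewrite /= (nice_top nv); apply/seteqP; split.
- exists void, (fun=> true_formula L n), xpred0 => M N d Om P fK fB nv a b.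
  by rewrite /= (nice_bot nv); apply/seteqP; split.
- apply: (pattern_determined_op (op := andb)) ihs iht => M N d Om P fK fB nv a b.
  rewrite /= (nice_meet nv); apply/seteqP; split=> w /=.
    by move=> [/asboolP -> /asboolP ->].
  by move=> /andP[/asboolP ? /asboolP].
- apply: (pattern_determined_op (op := orb)) ihs iht => M N d Om P fK fB nv a b.
  rewrite /= (nice_join nv); apply/seteqP; split=> w /=.
    by move=> [/asboolP ->|/asboolP ->]; rewrite ?orbT.
  by move=> /orP[/asboolP ?|/asboolP ?]; [left|right].
- apply: (pattern_determined_op (op := fun c _ => ~~ c) _ iht iht) => M N d Om P fK fB nv a b.
  by rewrite /= (nice_neg nv); apply/seteqP; split=> w /= /asboolPn.
Qed.

Lemma qf_determined_mu n m (t : bterm L n m) : qf_determined (CMu R t).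
Proof.
move=> e e0; have [I [F [h hF]]] := bterm_pattern t.
exists I, F, e; split=> // M N d Om P fK fB nv a a' b b' cl /=.
by rewrite !(nice_mu_pr nv) !(hF _ _ _ _ _ _ _ nv); exact: cl.
Qed.

(** Reduces the two distance predicates to measures of terms, as which they can be written in nice
    randomizations. *)
Lemma qf_determined_eq n m (Phi Psi : cformula R L n m) :
  (forall (M : structure L) (N : interpretation R L), nice_randomization M N ->
     forall a b, ceval (N := N) Phi a b = ceval Psi a b) ->
  qf_determined Psi -> qf_determined Phi.
Proof.
move=> E qf e e0; have [I [F [dl [dl0 h]]]] := qf e e0.
exists I, F, dl; split=> // M N d Om P fK fB nv a a' b b' cl /=.
have nN : nice_randomization M N by exists d, Om, P, fK, fB.
by rewrite !(E M N nN); exact: h nv _ _ _ _ cl.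
Qed.

Lemma fin_positive_lb k (dl : 'I_k -> R) : (forall i, 0 < dl i) ->
  exists2 r, 0 < r & forall i, r <= dl i.
Proof.
(* The initial value 1 covers [k = 0]. *)
move=> dl0; exists (\big[Order.min/1]_i dl i); last by move=> i; exact: bigmin_le_cond.
by apply: lt_bigmin; rewrite ?ltr01.
Qed.

(** Uniform continuity of [u] turns a common error [r / 2] in the arguments into an error [e]. The
    formulas of all the arguments are collected in a disjoint union, with the least of their
    tolerances. *)
Lemma qf_determined_conn n m k (u : connective R k) (Ps : 'I_k -> cformula R L n m) :
  (forall i, qf_determined (Ps i)) -> qf_determined (CConn u Ps).
Proof.
move=> qf e e0; have [r r0 hr] := connective_unif_continuous u e0.
have r20 : 0 < r / 2 by rewrite divr_gt0.
have /choice[t ht] i : exists t : {I : finType & ((I -> formula L n) * R)%type},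
    0 < (tagged t).2 /\
    forall (M : structure L) (N : interpretation R L) d (Om : measurableType d)
      (P : probability Om R) (fK : elt N -> Om -> M) (fB : evt N -> set Om),
      nice_randomization_via P fK fB -> forall a a' b b',
      tvclose P (tagged t).2 (pattern fK fB (tagged t).1 a b)
         (pattern fK fB (tagged t).1 a' b') ->
      `|ceval (N := N) (Ps i) a b - ceval (Ps i) a' b'| <= r / 2.
  have [I [F [dl hF]]] := qf i _ r20.
  by exists (existT _ I (F, dl)).
have [dl dl0 hdl] := fin_positive_lb (fun i => (ht i).1).
exists {i : 'I_k & tag (t i)}, (fun s => (tagged (t (tag s))).1 (tagged s)), dl.
split=> // M N d Om P fK fB nv a a' b b' cl /=.
apply/ltW/hr => [i|i|i]; rewrite !mxE; [exact: (ceval01 (nice_prestructure nv))..|].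
apply: (@le_lt_trans _ _ (r / 2)); last by rewrite ltr_pdivrMr // ltr_pMr // ltr1n.
apply: (ht i).2 nv _ _ _ _ _; apply: tvclose_le (hdl i) _.
pose c (p : {ffun {i : 'I_k & tag (t i)} -> bool} * {ffun 'I_m -> bool}) :=
  ([ffun j => p.1 (Tagged (fun i => tag (t i)) j)] : {ffun tag (t i) -> bool}, p.2).
suff E (a0 : 'I_n -> elt N) b0 : pattern fK fB (tagged (t i)).1 a0 b0 =
  (fun w => c (pattern fK fB (fun s => (tagged (t (tag s))).1 (tagged s)) a0 b0 w)).
  by rewrite !E; exact: (tvclose_comp c cl).
by apply/funext => w; congr (_, _); apply/ffunP => j; rewrite !ffunE.
Qed.

Section Quantifiers.
Context {X : Type} (f f' : X -> R) (e : R).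
Hypotheses (X0 : inhabited X) (f01 : forall x, 0 <= f x <= 1)
  (f'01 : forall x, 0 <= f' x <= 1).

Lemma sup_range_le_add : (forall x, exists x', f x <= f' x' + e) ->
  sup (range f) <= sup (range f') + e.
Proof.
move=> h; apply: ge_sup; first by case: X0 => x; exists (f x), x.
move=> _ [x _ <-]; have [x' hx'] := h x; apply: le_trans hx' _.
by rewrite lerD2r; case: (sup_range01 X0 f'01).
Qed.

Lemma inf_range_le_add : (forall x', exists x, f x <= f' x' + e) ->
  inf (range f) <= inf (range f') + e.
Proof.
move=> h; rewrite -lerBlDr; apply: lb_le_inf; first by case: X0 => x; exists (f' x), x.
move=> _ [x' _ <-]; have [x hx] := h x'; rewrite lerBlDr; apply: le_trans hx.
by case: (inf_range01 X0 f01).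
Qed.
End Quantifiers.

(** Closeness of laws is symmetric, so a one-sided estimate suffices. *)
Lemma qf_determined_sym n m (Phi : cformula R L n m) :
  (forall e : R, 0 < e ->
  exists (I : finType) (F : I -> formula L n) (dl : R), 0 < dl /\
    forall (M : structure L) (N : interpretation R L) d (Om : measurableType d)
      (P : probability Om R) (fK : elt N -> Om -> M) (fB : evt N -> set Om),
      nice_randomization_via P fK fB -> forall a a' b b',
      tvclose P dl (pattern fK fB F a b) (pattern fK fB F a' b') ->
      ceval (N := N) Phi a b <= ceval Phi a' b' + e) -> qf_determined Phi.
Proof.
move=> h e e0; have [I [F [dl [dl0 hF]]]] := h e e0.
exists I, F, dl; split=> // M N d Om P fK fB nv a a' b b' cl.
rewrite ler_norml lerBlDl lerNl opprB lerBlDl ![_ + e]addrC.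
have h1 := hF _ _ _ _ _ _ _ nv _ _ _ _ cl.
have h2 := hF _ _ _ _ _ _ _ nv _ _ _ _ (tvclose_sym cl).
by apply/andP; split; lra.
Qed.

Lemma small_multiple (K : nat) (dl : R) : 0 < dl -> exists2 r, 0 < r & K%:R * r <= dl.
Proof.
(* The successor keeps the denominator nonzero. *)
move=> dl0; exists (dl / K.+1%:R); first by rewrite divr_gt0.
by rewrite mulrA ler_pdivrMr // mulrC ler_pM2l // ler_nat.
Qed.

(** Induction on [Phi]. At a quantifier the extension lemmas copy a new variable at the cost of a
    factor in the tolerance. This factor is the size of a finite type independent of the
    randomization, so it is divided out in advance. Suprema copy from the first tuple to the second,
    infima from the second to the first. *)
Lemma quantifier_elimination n m (Phi : cformula R L n m) : qf_determined Phi.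
Proof.
elim: Phi => {n m} [n m t|n m i j|n m s t|n m k u Ps ih|n m Q ih|n m Q ih|n m Q ih|n m Q ih].
- exact: qf_determined_mu.
- apply: (@qf_determined_eq _ _ _ (CMu R (BEv m (neq_formula L)
    (cons_env i (cons_env j nil_env))))) => [M N [d [W [P [fK [fB nv]]]]] a b /=|].
    rewrite (nice_dK nv) !(cons_env_comp a); congr (mu (ev _ (cons_env _ (cons_env _ _)))).
    by rewrite (nil_envE (fun i => _)).
  exact: qf_determined_mu.
- apply: (@qf_determined_eq _ _ _ (CMu R (BJoin (BMeet s (BNeg t)) (BMeet t (BNeg s)))))
    => [M N [d [W [P [fK [fB nv]]]]] a b /=|].
    rewrite (nice_mu_pr nv) (nice_dB_pr nv) (nice_join nv) !(nice_meet nv) !(nice_neg nv).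
    by rewrite -!setDE.
  exact: qf_determined_mu.
- exact: qf_determined_conn.
- apply: qf_determined_sym => e e0; have [I [F [dl [dl0 h]]]] := ih e e0.
  have [r r0 hr] := small_multiple
    #|{: ({ffun {ffun I -> bool} -> bool} * {ffun 'I_m -> bool}) * {ffun I -> bool}}| dl0.
  exists {ffun I -> bool}, (fun y => Ex (pattern_formula F y)), r.
  split=> // M N d Om P fK fB nv a a' b b' cl /=.
  apply: sup_range_le_add => [||x]; [exact: elt_inhabited (nice_prestructure nv)|
    move=> x; exact: (ceval01 (nice_prestructure nv))|].
  have [x' cl'] := pattern_extend_elt nv x hr cl; exists x'.
  by have := h _ _ _ _ _ _ _ nv _ _ _ _ cl'; rewrite ler_norml => /andP[_]; rewrite lerBlDl addrC.
- apply: qf_determined_sym => e e0; have [I [F [dl [dl0 h]]]] := ih e e0.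
  have [r r0 hr] := small_multiple
    #|{: ({ffun {ffun I -> bool} -> bool} * {ffun 'I_m -> bool}) * {ffun I -> bool}}| dl0.
  exists {ffun I -> bool}, (fun y => Ex (pattern_formula F y)), r.
  split=> // M N d Om P fK fB nv a a' b b' cl /=.
  apply: inf_range_le_add => [||x']; [exact: elt_inhabited (nice_prestructure nv)|
    move=> x; exact: (ceval01 (nice_prestructure nv))|].
  have [x cl'] := pattern_extend_elt nv x' hr (tvclose_sym cl); exists x.
  by have := h _ _ _ _ _ _ _ nv _ _ _ _ (tvclose_sym cl');
    rewrite ler_norml => /andP[_]; rewrite lerBlDl addrC.
- apply: qf_determined_sym => e e0; have [I [F [dl [dl0 h]]]] := ih e e0.
  have [r r0 hr] := small_multiple
    #|{: ({ffun I -> bool} * {ffun 'I_m -> bool}) * bool}| dl0.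
  exists I, F, r; split=> // M N d Om P fK fB nv a a' b b' cl /=.
  apply: sup_range_le_add => [||x]; [exact: evt_inhabited|
    move=> x; exact: (ceval01 (nice_prestructure nv))|].
  have [x' cl'] := pattern_extend_evt nv x hr cl; exists x'.
  by have := h _ _ _ _ _ _ _ nv _ _ _ _ cl'; rewrite ler_norml => /andP[_]; rewrite lerBlDl addrC.
- apply: qf_determined_sym => e e0; have [I [F [dl [dl0 h]]]] := ih e e0.
  have [r r0 hr] := small_multiple
    #|{: ({ffun I -> bool} * {ffun 'I_m -> bool}) * bool}| dl0.
  exists I, F, r; split=> // M N d Om P fK fB nv a a' b b' cl /=.
  apply: inf_range_le_add => [||x']; [exact: evt_inhabited|
    move=> x; exact: (ceval01 (nice_prestructure nv))|].
  have [x cl'] := pattern_extend_evt nv x' hr (tvclose_sym cl); exists x.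
  by have := h _ _ _ _ _ _ _ nv _ _ _ _ (tvclose_sym cl');
    rewrite ler_norml => /andP[_]; rewrite lerBlDl addrC.
Qed.
End QuantifierElimination.

(** * Perturbing an event within the cells of its parameters *)

(** As [c] varies, these are the finitely many unions of cells; a minimum over [c] is therefore
    expressible by a formula. *)
Definition pattern_union L n (I : finType) (F : I -> formula L n)
    (c : {ffun {ffun I -> bool} -> bool}) : formula L n :=
  big_or [seq pattern_formula F q | q <- enum (c : pred {ffun I -> bool})].

Section Perturbation.
Context {R : realType} {L : signature} {M : structure L} {N : interpretation R L}
  {d : measure_display} {Om : measurableType d} {P : probability Om R}.
Context {fK : elt N -> Om -> M} {fB : evt N -> set Om}.
Hypothesis nv : nice_randomization_via P fK fB.
Local Notation pr := (pr P).

(** [B] is as disjoint from [A] as its measure allows. The bit [c] tells whether [A] is to be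
    compared with all of [C] or with the empty set. *)
Lemma perturb_cell (A C : set Om) : measurable A -> measurable C -> A `<=` C ->
  exists (B : set Om) (c : bool), [/\ measurable B, B `<=` C, pr B = pr A &
    if c then C `\` A `<=` B else A `<=` ~` B].
Proof.
move=> mA mC AC; have mCA : measurable (C `\` A) by exact: measurableD.
have [le|lt] := leP (pr A) (pr (C `\` A)).
  have [|B [mB BCA prB]] := atomless_intermediate (c := pr A) (nice_atomless nv) mCA.
    by rewrite pr_ge0.
  exists B, false; split=> // [w /BCA[]//|w Aw /BCA[_]]; exact.
(* [A] is now more than half of [C]: take all of [C] outside [A], and give up a part [D] of [A] of
   the same measure. *)
have [|D [mD DA prD']] := atomless_intermediate (c := pr (C `\` A)) (nice_atomless nv) mA.
  by rewrite pr_ge0 ltW.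
exists ((C `\` A) `|` (A `\` D)), true; split.
- by apply: measurableU => //; exact: measurableD.
- by move=> w [[]|[/AC]].
- rewrite prU //; [|exact: measurableD|].
    by rewrite [pr (A `\` D)]prD // prD'; lra.
  by apply/seteqP; split=> // w [[_ nA] [Aw _]].
- by move=> w CAw; left.
Qed.

(* In each cell of the pattern of [a], [x'] is as far as possible from [x] among
   the events of the same measure; this is at least as far as the cell or the
   empty set. *)
Lemma perturb_evt n (I : finType) (F : I -> formula L n) (a : 'I_n -> elt N) (x : evt N) :
  exists (x' : evt N) (c : {ffun {ffun I -> bool} -> bool}),
    tvclose P 0 (pattern fK fB F a (cons_env x nil_env))
      (pattern fK fB F a (cons_env x' nil_env)) /\
    dB x (ev (pattern_union F c) a) <= dB x x'.
Proof.
pose f w := sat_pattern F (fun i => fK (a i) w).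
have mf : fin_measurable f by exact: (fin_measurable_sat_pattern nv).
have mx : measurable (fB x) by exact: (nice_measurable nv).
have /choice[Bc hBc] q : exists Bc : set Om * bool,
    [/\ measurable Bc.1, Bc.1 `<=` [set w | f w = q],
        pr Bc.1 = pr (fB x `&` [set w | f w = q]) &
    if Bc.2 then [set w | f w = q] `\` (fB x `&` [set w | f w = q]) `<=` Bc.1
    else fB x `&` [set w | f w = q] `<=` ~` Bc.1].
  have [|B [c h]] := perturb_cell (measurableI _ _ mx (mf q)) (mf q).
    exact: subIsetr.
  by exists (B, c).
pose B := [set w | (Bc (f w)).1 w].
have mB : measurable B.
  rewrite (_ : B = \bigcup_(q in [set: {ffun I -> bool}]) (Bc q).1).
    by apply: fin_bigcup_measurable => // q _; case: (hBc q).
  apply/seteqP; split=> [w Bw|w [q _ Bw]]; first by exists (f w).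
  by have [_ sub _ _] := hBc q; rewrite /B /= (sub _ Bw).
have [x' hx'] := nice_measurable_evt nv mB.
exists x', [ffun q => (Bc q).2]; split.
  (* In each cell [x] and [x'] have equal measure, hence so do their complements; the laws agree
     exactly. *)
  apply: (tvclose_cells (e := 0)); rewrite ?mulr0 //.
    exact: (fin_measurable_pattern nv).
    exact: (fin_measurable_pattern nv).
  move=> [q y]; have [mBq subq prq _] := hBc q.
  have cellE (e : evt N) : [set w | pattern fK fB F a (cons_env e nil_env) w = (q, y)] =
      if y ord0 then [set w | f w = q] `&` fB e
      else [set w | f w = q] `\` ([set w | f w = q] `&` fB e).
    apply/seteqP; split=> w.
      move=> [fq <-]; rewrite ffunE cons_env0; case: asboolP => we; split=> //.
      by case.
    move=> hw; congr (_, _).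
      by move: hw; case: ifP => _ [].
    apply/ffunP => i; rewrite ffunE (ord1 i) cons_env0; move: hw.
    case: (y ord0) => -[fq we]; first exact/asboolP.
    by apply/asboolPn => ew; apply: we.
  have BqE : [set w | f w = q] `&` fB x' = (Bc q).1.
    rewrite hx'; apply/seteqP; split=> w; first by move=> [<-].
    by move=> Bw; rewrite /B /= (subq _ Bw); split=> //; exact: subq.
  rewrite !cellE BqE [_ `&` fB x]setIC; case: (y ord0).
    by rewrite prq subrr normr0.
  rewrite !prD ?prq ?subrr ?normr0 //; exact: measurableI.
rewrite !(nice_dB_pr nv) hx'.
have unionE : fB (ev (pattern_union F [ffun q => (Bc q).2]) a) = [set w | (Bc (f w)).2].
  rewrite (nice_ev nv); apply/seteqP; split=> w; rewrite /mkset sat_big_or.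
    by move=> [q]; rewrite ffunE => cq /sat_pattern_formula; rewrite -/(f w) => ->.
  by exists (f w); [rewrite ffunE|apply/sat_pattern_formula].
rewrite unionE; apply: le_pr.
- apply: measurableU; apply: measurableD => //;
  exact: (fin_measurable_pred (fun q => (Bc q).2) mf).
- by apply: measurableU; exact: measurableD.
(* In a selected cell, points where [x] and the union differ lie outside [x], hence in [x']; in the
   other cells they lie in [x], hence outside [x']. *)
- move=> w; have [_ _ _] := hBc (f w).
  rewrite /setY /B /=; case: (Bc (f w)) => Bw [] /= sub [] [h1 h2] //.
  + by right; split=> //; apply: sub; split=> // -[].
  + by left; split=> //; exact: sub.
Qed.

End Perturbation.

(** The formulas [F] are chosen before the randomization and the parameters, which is what allows
    the conclusion to become a sentence of T^R. *)
Lemma definable_perturbation (R : realType) L n (Phi : cformula R L n 1) (e : R) : 0 < e ->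
  exists (I : finType) (F : I -> formula L n),
    forall (M : structure L) (N : interpretation R L), nice_randomization M N ->
    forall a x, exists x' c,
      `|ceval (N := N) Phi a (cons_env x' nil_env) - ceval Phi a (cons_env x nil_env)| <= e /\
      dB x (ev (pattern_union F c) a) <= dB x x'.
Proof.
move=> e0; have [I [F [dl [dl0 h]]]] := quantifier_elimination Phi e0.
exists I, F => M N [d [W [P [fK [fB nv]]]]] a x.
have [x' [c [cl le]]] := perturb_evt nv F a x; exists x', c; split=> //.
by apply: h nv _ _ _ _ _; apply: tvclose_le (ltW dl0) _; exact: tvclose_sym.
Qed.

(** * Continuous connectives and the perturbation sentence *)

Section Connectives.
Context {R : realType}.

Definition conn2 (op : R -> R -> R)
    (op_continuous : continuous (fun v : 'rV[R]_2 => op (v ord0 ord0) (v ord0 ord_max)))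
    (op01 : forall x y, 0 <= x <= 1 -> 0 <= y <= 1 -> 0 <= op x y <= 1) : connective R 2 :=
  Connective (continuous_subspaceT op_continuous)
    (fun v hv => op01 _ _ (hv ord0) (hv ord_max)).

Lemma sub_continuous :
  continuous (fun v : 'rV[R]_2 => Num.max 0 (v ord0 ord0 - v ord0 ord_max)).
Proof.
move=> v; apply: (@continuous_max R 'rV[R]_2); first exact: cst_continuous.
by apply: continuousB; exact: coord_continuous.
Qed.

Lemma max_continuous :
  continuous (fun v : 'rV[R]_2 => Num.max (v ord0 ord0) (v ord0 ord_max)).
Proof. by move=> v; apply: (@continuous_max R 'rV[R]_2); exact: coord_continuous. Qed.

Lemma min_continuous :
  continuous (fun v : 'rV[R]_2 => Num.min (v ord0 ord0) (v ord0 ord_max)).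
Proof. by move=> v; apply: (@continuous_min R 'rV[R]_2); exact: coord_continuous. Qed.

Lemma sub01 (x y : R) : 0 <= x <= 1 -> 0 <= y <= 1 -> 0 <= Num.max 0 (x - y) <= 1.
Proof. by rewrite le_max lexx ge_max ler01 /=; lra. Qed.

Lemma max01 (x y : R) : 0 <= x <= 1 -> 0 <= y <= 1 -> 0 <= Num.max x y <= 1.
Proof. by move=> x01 y01; case: (leP x y). Qed.

Lemma min01 (x y : R) : 0 <= x <= 1 -> 0 <= y <= 1 -> 0 <= Num.min x y <= 1.
Proof. by move=> x01 y01; case: (leP x y). Qed.

(** Truncated subtraction: its vanishing expresses an inequality between formulas. *)
Definition conn_sub := conn2 sub_continuous sub01.
Definition conn_max := conn2 max_continuous max01.
Definition conn_min := conn2 min_continuous min01.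

Definition conn_cst (r : R) (r01 : 0 <= r <= 1) : connective R 0 :=
  Connective (continuous_subspaceT (@cst_continuous 'rV[R]_0 R r)) (fun _ _ => r01).

Context {L : signature} {n m : nat}.
Implicit Types Phi Psi : cformula R L n m.

Definition CBin (u : connective R 2) Phi Psi : cformula R L n m :=
  CConn u (fun i => if i == ord0 then Phi else Psi).
Definition CCst (r : R) (r01 : 0 <= r <= 1) : cformula R L n m :=
  CConn (conn_cst r01) (fun=> CMu R (BTop L n m)).
Definition CDist Phi Psi := CBin conn_max (CBin conn_sub Phi Psi) (CBin conn_sub Psi Phi).

Context {N : interpretation R L}.
Variables (a : 'I_n -> elt N) (b : 'I_m -> evt N).

Lemma ceval_sub Phi Psi :
  ceval (CBin conn_sub Phi Psi) a b = Num.max 0 (ceval Phi a b - ceval Psi a b).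
Proof. by rewrite /= !mxE. Qed.

Lemma ceval_max Phi Psi :
  ceval (CBin conn_max Phi Psi) a b = Num.max (ceval Phi a b) (ceval Psi a b).
Proof. by rewrite /= !mxE. Qed.

Lemma ceval_min Phi Psi :
  ceval (CBin conn_min Phi Psi) a b = Num.min (ceval Phi a b) (ceval Psi a b).
Proof. by rewrite /= !mxE. Qed.

Lemma ceval_dist Phi Psi : ceval (CDist Phi Psi) a b = `|ceval Phi a b - ceval Psi a b|.
Proof.
rewrite ceval_max !ceval_sub; move: (ceval Phi a b) (ceval Psi a b) => x y.
have [xy|/ltW yx] := leP x y.
  rewrite (max_l _ : Num.max 0 (x - y) = 0) ?subr_le0 // distrC ger0_norm ?subr_ge0 //.
  by rewrite !(max_r, subr_ge0).
rewrite (max_l _ : Num.max 0 (y - x) = 0) ?subr_le0 // ger0_norm ?subr_ge0 //.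
by rewrite max_l max_r ?le_max ?subr_ge0 ?lexx ?yx.
Qed.

(** Finite disjunction in continuous logic; [c0] seeds the fold with a member of the family, so that
    the minimum is attained. *)
Definition CMin (C : finType) (Ps : C -> cformula R L n m) (c0 : C) :=
  foldr (fun c => CBin conn_min (Ps c)) (Ps c0) (enum C).

Lemma ceval_CMin_le (C : finType) (Ps : C -> cformula R L n m) c0 c :
  ceval (CMin Ps c0) a b <= ceval (Ps c) a b.
Proof.
rewrite /CMin; have : c \in enum C by rewrite mem_enum.
elim: (enum C) => // c' s ih; rewrite inE [foldr _ _ _]/= ceval_min ge_min.
by move=> /predU1P[->|/ih ->]; rewrite ?lexx ?orbT.
Qed.

Lemma ceval_CMin_attained (C : finType) (Ps : C -> cformula R L n m) c0 :
  exists c, ceval (CMin Ps c0) a b = ceval (Ps c) a b.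
Proof.
rewrite /CMin; elim: (enum C) => [|c' s [c hc]]; first by exists c0.
rewrite [foldr _ _ _]/= ceval_min hc; case: leP => _; [by exists c'|by exists c].
Qed.

End Connectives.

Section PerturbationSentence.
Context {R : realType} {L : signature}.

(** The sentence says that, for all [a] and [x], the infimum over [x'] of [Theta] is 0, where
    [Theta] bounds both excesses. The bound [e <= 1] makes [e] a legitimate constant connective. An
    approximate witness in [N] leaves each excess below [e], whence [2 * e] and the added [e]. *)
Lemma model_perturbation (T : theory L) (N : interpretation R L) n
    (Phi : cformula R L n 1) (e : R) :
  is_model_of_randomization T N -> 0 < e <= 1 ->
  exists (I : finType) (F : I -> formula L n), forall a x, exists x' c,
    `|ceval (N := N) Phi a (cons_env x' nil_env) - ceval Phi a (cons_env x nil_env)| < 2 * e /\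
    dB x (ev (pattern_union F c) a) < dB x x' + e.
Proof.
move=> hN /andP[e0 e1]; have e01 : 0 <= e <= 1 by rewrite ltW.
have [I [F hF]] := definable_perturbation Phi e0.
exists I, F => a x.
(* The innermost quantifier binds [x'], so [x'] is variable 0 and [x] variable 1. *)
pose X' : 'I_2 := ord0; pose X : 'I_2 := lift ord0 ord0.
pose Theta : cformula R L n 2 := CBin conn_max
  (CBin conn_sub (CDist (rename_cformula Phi (fun=> X')) (rename_cformula Phi (fun=> X)))
                 (CCst e01))
  (CBin conn_sub (CMin (fun c => CdB R (BVar L n X) (BEv 2 (pattern_union F c) id)) [ffun=> false])
                 (CdB R (BVar L n X) (BVar L n X'))).
have ren (N' : interpretation R L) (Psi : cformula R L n 1) a' y y' (b : 'I_0 -> evt N') :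
    ceval (rename_cformula Psi (fun=> X')) a' (cons_env y' (cons_env y b)) =
    ceval Psi a' (cons_env y' nil_env) /\
    ceval (rename_cformula Psi (fun=> X)) a' (cons_env y' (cons_env y b)) =
    ceval Psi a' (cons_env y nil_env).
  rewrite !ceval_rename; split; congr ceval; apply/funext => i; rewrite (ord1 i).
    by rewrite !cons_env0.
  by rewrite cons_env_lift !cons_env0.
have ThetaE (N' : interpretation R L) a' (y y' : evt N') b :
    ceval Theta a' (cons_env y' (cons_env y b)) = Num.max
      (Num.max 0 (`|ceval Phi a' (cons_env y' nil_env) - ceval Phi a' (cons_env y nil_env)| - e))
      (Num.max 0 (ceval (CMin (fun c => CdB R (BVar L n X) (BEv 2 (pattern_union F c) id))
          [ffun=> false]) a' (cons_env y' (cons_env y b)) - dB y y')).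
  rewrite ceval_max !ceval_sub ceval_dist !(ren _ _ _ _ _ _).1 !(ren _ _ _ _ _ _).2.
  by rewrite [ceval (CdB _ _ _) _ _]/= cons_env_lift !cons_env0.
have [pre _ _ _] := hN.1.
have [] := @ceval_CInfB_witness _ _ N pre _ _ Theta a (cons_env x nil_env) e e0.
  apply: (transfer (Phi := CInfB Theta) hN) => M N0 nN0 a0 b0.
  rewrite (cons_env_eta b0); move: (b0 ord0) (fun i => _) => y b.
  have [y' [c [h1 h2]]] := hF M N0 nN0 a0 y.
  have pre0 : is_prestructure N0 by case: nN0 => ? [? [? [? [? []]]]].
  apply: (@ceval_CInfB_eq0 _ _ N0 pre0 _ _ _ _ _ y'); rewrite ThetaE.
  have := ceval_CMin_le a0 (cons_env y' (cons_env y b))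
    (fun c => CdB R (BVar L n X) (BEv 2 (pattern_union F c) id)) [ffun=> false] c.
  rewrite [ceval (CdB _ _ _) _ _]/= cons_env_lift cons_env0 => h3.
  by rewrite !max_l // subr_le0 // (le_trans h3).
move=> x'; rewrite ThetaE !gt_max => /andP[/andP[_ h1] /andP[_]].
have [c ->] := ceval_CMin_attained a (cons_env x' (cons_env x nil_env))
    (fun c => CdB R (BVar L n X) (BEv 2 (pattern_union F c) id)) [ffun=> false].
rewrite [ceval (CdB _ _ _) _ _]/= cons_env_lift cons_env0 => h2.
by exists x', c; split; lra.
Qed.
End PerturbationSentence.

(** * The event algebra of a model of T^R *)

Section ModelsOfRandomization.
Context {R : realType} {L : signature} {T : theory L} {N : interpretation R L}.
Hypothesis hN : is_model_of_randomization T N.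
Implicit Types (b c s : evt N) (u v : nat -> evt N).

Let pre : is_prestructure N. Proof. by case: hN.1. Qed.

Lemma dB_refl b : dB b b = 0.
Proof. by case: (dB_pseudometric pre). Qed.

Lemma dB_sym b c : dB b c = dB c b.
Proof. by case: (dB_pseudometric pre). Qed.

Lemma dB_triangle c b s : dB b s <= dB b c + dB c s.
Proof. by case: (dB_pseudometric pre) => _ _ _; exact. Qed.

Lemma dB_eq b c : (forall e : R, 0 < e -> dB b c < e) -> b = c.
Proof.
move=> h; have [_ _ _ sep] := hN.1; apply: sep.
have [h01 _ _ _] := dB_pseudometric pre; case/andP: (h01 b c) => ge0 _.
by apply/eqP; rewrite eq_le ge0 andbT leNgt; apply/negP => /h; rewrite ltxx.
Qed.

(** Boolean laws are checked on sets and transferred; laws with fewer than three variables repeat an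
    argument. *)
Lemma evt_identity (t t' : bterm L 0 3) :
  (forall (M : structure L) (N0 : interpretation R L) d (Om : measurableType d)
     (P : probability Om R) fK fB,
     nice_randomization_via (M := M) (N := N0) P fK fB ->
     forall a h, fB (bteval a h t) = fB (bteval a h t')) ->
  forall b c s, bteval (N := N) nil_env (cons_env b (cons_env c (cons_env s nil_env))) t =
    bteval nil_env (cons_env b (cons_env c (cons_env s nil_env))) t'.
Proof. by move=> h b c s; exact: (transfer_bterm hN h). Qed.

Local Notation X0 := (BVar L 0 (ord0 : 'I_3)).
Local Notation X1 := (BVar L 0 (lift ord0 ord0 : 'I_3)).
Local Notation X2 := (BVar L 0 (lift ord0 (lift ord0 ord0) : 'I_3)).

Local Ltac identity t t' b c s :=
  let h := fresh in let nv := fresh in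
  have h := @evt_identity t t' _ b c s;
  rewrite /= !(cons_env_lift, cons_env0) in h; apply: h;
  intros ? ? ? ? ? ? ? nv ? ?;
  rewrite /= ?(nice_join nv, nice_meet nv, nice_neg nv).

Lemma emeetC b c : emeet b c = emeet c b.
Proof. by identity (BMeet X0 X1) (BMeet X1 X0) b c c; rewrite setIC. Qed.

Lemma emeetA b c s : emeet b (emeet c s) = emeet (emeet b c) s.
Proof.
by identity (BMeet X0 (BMeet X1 X2)) (BMeet (BMeet X0 X1) X2) b c s; rewrite setIA.
Qed.

Lemma emeet_joinl b c s : emeet (ejoin b c) s = ejoin (emeet b s) (emeet c s).
Proof.
by identity (BMeet (BJoin X0 X1) X2) (BJoin (BMeet X0 X2) (BMeet X1 X2)) b c s; rewrite setIUl.
Qed.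

Lemma emeet_joinKl b c : emeet b (ejoin b c) = b.
Proof. by identity (BMeet X0 (BJoin X0 X1)) constr:(X0) b c c; apply/seteqP; split=> w /=; tauto. Qed.

Lemma emeet_joinKr b c : emeet c (ejoin b c) = c.
Proof. by identity (BMeet X1 (BJoin X0 X1)) constr:(X1) b c c; apply/seteqP; split=> w /=; tauto. Qed.

Lemma emeetxx b : emeet b b = b.
Proof. by identity (BMeet X0 X0) constr:(X0) b b b; rewrite setIid. Qed.

Lemma ejoinxx b : ejoin b b = b.
Proof. by identity (BJoin X0 X0) constr:(X0) b b b; rewrite setUid. Qed.

Lemma enegK b : eneg (eneg b) = b.
Proof. by identity (BNeg (BNeg X0)) constr:(X0) b b b; rewrite setCK. Qed.

Lemma emeet_neg_meet b c : emeet (eneg c) (eneg (emeet b c)) = eneg c.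
Proof.
by identity (BMeet (BNeg X1) (BNeg (BMeet X0 X1))) (BNeg X1) b c c;
  apply/seteqP; split=> w /=; tauto.
Qed.

Lemma ev_neg n (phi : formula L n) (a : 'I_n -> elt N) : ev (Not phi) a = eneg (ev phi a).
Proof.
apply: (@transfer_bterm _ _ T N n 0 (BEv 0 (Not phi) id) (BNeg (BEv 0 phi id)) hN _ a nil_env).
by move=> M N0 d Om P fK fB nv a0 b0; rewrite /= (nice_neg nv) !(nice_ev nv).
Qed.

Lemma ev_and n (phi psi : formula L n) (a : 'I_n -> elt N) :
  ev (And phi psi) a = emeet (ev phi a) (ev psi a).
Proof.
apply: (@transfer_bterm _ _ T N n 0 (BEv 0 (And phi psi) id)
  (BMeet (BEv 0 phi id) (BEv 0 psi id)) hN _ a nil_env).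
by move=> M N0 d Om P fK fB nv a0 b0; rewrite /= (nice_meet nv) !(nice_ev nv).
Qed.

Lemma ev_or n (phi psi : formula L n) (a : 'I_n -> elt N) :
  ev (Or phi psi) a = ejoin (ev phi a) (ev psi a).
Proof.
apply: (@transfer_bterm _ _ T N n 0 (BEv 0 (Or phi psi) id)
  (BJoin (BEv 0 phi id) (BEv 0 psi id)) hN _ a nil_env).
by move=> M N0 d Om P fK fB nv a0 b0; rewrite /= (nice_join nv) !(nice_ev nv).
Qed.

Lemma ev_rename n n' (phi : formula L n) (f : 'I_n -> 'I_n') (a : 'I_n' -> elt N) :
  ev (rename_formula phi f) a = ev phi (fun i => a (f i)).
Proof.
apply: (@transfer_bterm _ _ T N n' 0 (BEv 0 (rename_formula phi f) id)
  (BEv 0 phi f) hN _ a nil_env).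
move=> M N0 d Om P fK fB nv a0 b0; rewrite /= !(nice_ev nv).
by apply/seteqP; split=> w; rewrite /= sat_rename.
Qed.

Lemma ev_true n (a : 'I_n -> elt N) : ev (true_formula L n) a = etop.
Proof.
apply: (@transfer_bterm _ _ T N n 0 (BEv 0 (true_formula L n) id)
  (BTop L n 0) hN _ a nil_env).
by move=> M N0 d Om P fK fB nv a0 b0; rewrite /= (nice_ev nv) (nice_top nv); apply/seteqP; split.
Qed.

Lemma ev_false n (a : 'I_n -> elt N) : ev (Not (true_formula L n)) a = ebot.
Proof.
apply: (@transfer_bterm _ _ T N n 0 (BEv 0 (Not (true_formula L n)) id)
  (BBot L n 0) hN _ a nil_env).
move=> M N0 d Om P fK fB nv a0 b0; rewrite /= (nice_ev nv) (nice_bot nv).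
by apply/seteqP; split=> // w; apply.
Qed.

(** Writing [emeet b c] for an event below [c] makes the additivity of the measure on nested events
    an unconditional formula, to which transfer applies. *)
Lemma dB_meet_mu b c : mu (emeet b c) <= mu c /\ dB (emeet b c) c = mu c - mu (emeet b c).
Proof.
pose Y0 := BVar L 0 (ord0 : 'I_2); pose Y1 := BVar L 0 (lift ord0 ord0 : 'I_2).
have le : mu (emeet b c) <= mu c.
  have := @transfer _ _ T N 0 2 (CBin conn_sub (CMu R (BMeet Y0 Y1)) (CMu R Y1)) hN _
    nil_env (cons_env b (cons_env c nil_env)).
  rewrite ceval_sub [ceval (CMu _ _) _ _]/= [ceval (CMu _ Y1) _ _]/= cons_env_lift !cons_env0.
  move=> h; rewrite -subr_le0 -{}h ?le_max ?lexx ?orbT //.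
  move=> M N0 [d [W [P [fK [fB nv]]]]] a0 b0.
  rewrite ceval_sub /= !(nice_mu_pr nv) (nice_meet nv) max_l // subr_le0 le_pr //.
  - by apply: measurableI; exact: (nice_measurable nv).
  - exact: (nice_measurable nv).

split=> //.
(* The truncated difference is an honest one, by the inequality just proved. *)
have := @transfer _ _ T N 0 2 (CDist (CdB R (BMeet Y0 Y1) Y1)
  (CBin conn_sub (CMu R Y1) (CMu R (BMeet Y0 Y1)))) hN _
    nil_env (cons_env b (cons_env c nil_env)).
rewrite ceval_dist ceval_sub.
rewrite [ceval (CdB _ _ _) _ _]/= [ceval (CMu _ Y1) _ _]/= [ceval (CMu _ _) _ _]/=.
rewrite cons_env_lift !cons_env0 max_r ?subr_ge0 //.
move=> h; apply/eqP; rewrite -subr_eq0 -normr_eq0 {}h //.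
move=> M N0 [d [W [P [fK [fB nv]]]]] a0 b0.
rewrite ceval_dist ceval_sub /= !(nice_mu_pr nv) (nice_dB_pr nv) (nice_meet nv).
set B0 := fB _; set B1 := fB _.
have [m0 m1] : measurable B0 /\ measurable B1 by split; exact: (nice_measurable nv).
have sub : B0 `&` B1 `<=` B1 by exact: subIsetr.
have mI : measurable (B0 `&` B1) by exact: measurableI.
have -> : (B0 `&` B1) `+` B1 = B1 `\` (B0 `&` B1).
  by rewrite /setY (_ : (B0 `&` B1) `\` B1 = set0) ?set0U //; rewrite setD_eq0.
by rewrite prD // max_r ?subrr ?normr0 // subr_ge0 le_pr.
Qed.

Lemma ele_trans c b s : ele b c -> ele c s -> ele b s.
Proof. by rewrite /ele => bc cs; rewrite -bc -emeetA cs. Qed.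

Lemma ele_anti b c : ele b c -> ele c b -> b = c.
Proof. by rewrite /ele => bc cb; rewrite -bc emeetC. Qed.

Lemma ele_neg b c : ele b c -> ele (eneg c) (eneg b).
Proof. by rewrite /ele => bc; rewrite -{1}bc emeet_neg_meet. Qed.

Definition evt_lim u s := forall e : R, 0 < e -> \forall k \near \oo, dB (u k) s < e.

(** The order is an equation about meets, and meets are 1-Lipschitz, so it survives limits. *)
Lemma evt_lim_ele_le u s c : evt_lim u s -> (forall k, ele (u k) c) -> ele s c.
Proof.
move=> us uc; apply: dB_eq => e e0.
have [|K _ hK] := us (e / 2); first by rewrite divr_gt0.
have sK := hK K (leqnn K); rewrite /= in sK.
apply: le_lt_trans (dB_triangle (u K) _ _) _; rewrite [e]splitr ltrD //.
rewrite -[X in dB _ X](uc K); apply: le_lt_trans (meet_modulus pre _ _ _ _) _.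
by rewrite dB_refl addr0 dB_sym.
Qed.

Lemma evt_lim_ele_ge n u s c : evt_lim u s -> (forall k, (n <= k)%N -> ele c (u k)) -> ele c s.
Proof.
move=> us cu; apply: dB_eq => e e0.
have [K _ hK] := us e e0.
have sK := hK (maxn n K) (leq_maxr n K); rewrite /= in sK.
rewrite -[X in dB _ X](cu (maxn n K) (leq_maxl n K)).
by apply: le_lt_trans (meet_modulus pre _ _ _ _) _; rewrite dB_refl add0r dB_sym.
Qed.

Fixpoint ejoins u k := if k is k'.+1 then ejoin (ejoins u k') (u k) else u 0%N.

Lemma ejoins_mono u k l : (k <= l)%N -> ele (ejoins u k) (ejoins u l).
Proof.
elim: l => [|l ih]; first by rewrite leqn0 => /eqP ->; exact: emeetxx.
rewrite leq_eqVlt ltnS => /predU1P[->|/ih h]; first exact: emeetxx.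
by apply: ele_trans h _; exact: emeet_joinKl.
Qed.

Lemma ele_ejoins u k : ele (u k) (ejoins u k).
Proof. by case: k => [|k] /=; [exact: emeetxx|exact: emeet_joinKr]. Qed.

Lemma ejoins_ele u c : (forall k, ele (u k) c) -> forall k, ele (ejoins u k) c.
Proof. by move=> uc; elim=> [|k ih]; [exact: (uc 0%N)|rewrite /ele /= emeet_joinl ih uc]. Qed.

(** The measures of the partial joins increase to a finite supremum, and for nested events distance
    is the difference of measures. *)
Lemma ejoins_cauchy u (e : R) : 0 < e ->
  exists k0, forall k l, (k0 <= k)%N -> (k0 <= l)%N -> dB (ejoins u k) (ejoins u l) < e.
Proof.
move=> e0; pose S := range (fun k => mu (ejoins u k)).
have hS : has_sup S.
  split; first by exists (mu (ejoins u 0)), 0%N.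
  by exists 1 => _ [k _ <-]; case/andP: (mu_01 pre (ejoins u k)).
have [|_ [k0 _ <-] hk0] := @sup_adherent _ S (e / 2) _ hS; first by rewrite divr_gt0.
have near_k0 k : (k0 <= k)%N -> dB (ejoins u k0) (ejoins u k) < e / 2.
  move=> le; have [_] := dB_meet_mu (ejoins u k0) (ejoins u k).
  rewrite (ejoins_mono u le) => ->.
  have : mu (ejoins u k) <= sup S by apply: ub_le_sup; [exact: hS.2|exists k].
  lra.
exists k0 => k l hk hl; apply: le_lt_trans (dB_triangle (ejoins u k0) _ _) _.
by rewrite [e]splitr ltrD ?near_k0 // dB_sym near_k0.
Qed.

(** Completeness supplies a limit; since the order is closed under limits, it is the least upper
    bound. *)
Lemma ejoins_esup u : exists2 s, is_esup u s & evt_lim (ejoins u) s.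
Proof.
have [_ [_ cpl] _ _] := hN.1.
have [s hs] := cpl (ejoins u) (@ejoins_cauchy u).
exists s => //; split=> [k|c uc]; last by apply: evt_lim_ele_le hs _; exact: ejoins_ele.
apply: (evt_lim_ele_ge (n := k) hs) => l kl; apply: ele_trans (ele_ejoins u k) _.
exact: ejoins_mono.
Qed.

Lemma is_esup_unique u s s' : is_esup u s -> is_esup u s' -> s = s'.
Proof. by move=> [h1 h2] [h3 h4]; apply: ele_anti; [exact: h2|exact: h4]. Qed.

Lemma sub_clB (S : set (evt N)) : S `<=` clB S.
Proof. by move=> b Sb e e0; exists b; rewrite dB_refl. Qed.

Lemma clB_clB (S : set (evt N)) : clB (clB S) `<=` clB S.
Proof.
move=> b hb e e0; have e20 : 0 < e / 2 by rewrite divr_gt0.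
have [c [hc bc]] := hb _ e20; have [s [hs cs]] := hc _ e20.
exists s; split=> //; apply: le_lt_trans (dB_triangle c _ _) _.
by rewrite [e]splitr ltrD.
Qed.

Lemma clB_binop (op : evt N -> evt N -> evt N) (S : set (evt N)) :
  (forall b b' c c', dB (op b c) (op b' c') <= dB b b' + dB c c') ->
  (forall b c, S b -> S c -> S (op b c)) ->
  forall b c, clB S b -> clB S c -> clB S (op b c).
Proof.
move=> lip hS b c hb hc e e0; have e20 : 0 < e / 2 by rewrite divr_gt0.
have [b' [Sb bb']] := hb _ e20; have [c' [Sc cc']] := hc _ e20.
exists (op b' c'); split; first exact: hS.
by apply: le_lt_trans (lip _ _ _ _) _; rewrite [e]splitr ltrD.
Qed.

(** Concatenating the parameter tuples lets the first-order connectives be applied to both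
    formulas. *)
Lemma fdclB_common (A : set (elt N)) b c : fdclB A b -> fdclB A c ->
  exists n (phi psi : formula L n) (a : 'I_n -> elt N),
    [/\ forall i, A (a i), b = ev phi a & c = ev psi a].
Proof.
move=> [n [phi [a [Aa ->]]]] [m [psi [a' [Aa' ->]]]].
pose e (i : 'I_(n + m)) := match fintype.split i with inl j => a j | inr j => a' j end.
exists (n + m)%N, (rename_formula phi (@lshift n m)), (rename_formula psi (@rshift n m)), e.
split=> [i||]; first by rewrite /e; case: fintype.split.
  rewrite ev_rename; congr ev; apply/funext => j.
  by rewrite /e (unsplitK (inl j : 'I_n + 'I_m)).
rewrite ev_rename; congr ev; apply/funext => j.
by rewrite /e (unsplitK (inr j : 'I_n + 'I_m)).
Qed.

Lemma fdclB_meet (A : set (elt N)) b c : fdclB A b -> fdclB A c -> fdclB A (emeet b c).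
Proof.
move=> hb hc; have [n [phi [psi [a [Aa -> ->]]]]] := fdclB_common hb hc.
by exists n, (And phi psi), a; rewrite ev_and.
Qed.

Lemma fdclB_join (A : set (elt N)) b c : fdclB A b -> fdclB A c -> fdclB A (ejoin b c).
Proof.
move=> hb hc; have [n [phi [psi [a [Aa -> ->]]]]] := fdclB_common hb hc.
by exists n, (Or phi psi), a; rewrite ev_or.
Qed.

Lemma fdclB_neg (A : set (elt N)) b : fdclB A b -> fdclB A (eneg b).
Proof. by move=> [n [phi [a [Aa ->]]]]; exists n, (Not phi), a; rewrite ev_neg. Qed.

Lemma clB_fdclB_sigma (A : set (elt N)) : sigma_subalgebra (clB (fdclB A)).
Proof.
have join b c : clB (fdclB A) b -> clB (fdclB A) c -> clB (fdclB A) (ejoin b c).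
  by apply: clB_binop; [exact: join_modulus pre|exact: fdclB_join].
split=> //.
- apply: sub_clB; exists 0%N, (true_formula L 0), nil_env.
  by rewrite ev_true; split=> // -[].
- apply: sub_clB; exists 0%N, (Not (true_formula L 0)), nil_env.
  by rewrite ev_false; split=> // -[].
- by apply: clB_binop; [exact: meet_modulus pre|exact: fdclB_meet].
- move=> b hb e e0; have [c [hc bc]] := hb e e0.
  exists (eneg c); split; first exact: fdclB_neg.
  exact: le_lt_trans (neg_modulus pre _ _) bc.
(* A supremum is the metric limit of the finite joins, which already lie in the closure. *)
- move=> u s hu sup_s; have [s' sup_s' us'] := ejoins_esup u.
  rewrite (is_esup_unique sup_s sup_s'); apply: clB_clB => e e0.
  have [K _ hK] := us' e e0; exists (ejoins u K).
  split; last by rewrite dB_sym; exact: hK K (leqnn K).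
  by elim: K {hK} => [|K ih] /=; [exact: hu|exact: join].
Qed.

(* If [u k] tends to [b] with summable distances, the suprema [c n] of the [u k],
   [k >= n], lie above [b] and tend to [b]; hence [eneg b] is the supremum of the
   [eneg (c n)]. *)
Lemma sigma_subalgebra_closed (S : set (evt N)) : sigma_subalgebra S -> clB S `<=` S.
Proof.
move=> hS b hb.
pose r k : R := 1 / 2 ^+ k.
have r0 k : 0 < r k by rewrite divr_gt0 // exprn_gt0.
have rS k : r k = r k.+1 + r k.+1 by rewrite /r exprS invfM; lra.
have rlim e : 0 < e -> exists K, forall k, (K <= k)%N -> r k < e.
  by move=> e0; have [K _ hK] := near_infty_natSinv_expn_lt (PosNum e0); exists K.
have /choice[u hu] k : exists c, S c /\ dB b c < r k.+1 by exact: hb.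
have ulim n : evt_lim (fun k => u (n + k)%N) b.
  move=> e /rlim[K hK]; exists K => // k /= Kk; rewrite dB_sym.
  apply: lt_trans (hu _).2 (hK _ _); apply: leq_trans Kk _.
  by rewrite leqW // leq_addl.
have /choice[c hc] n : exists c, is_esup (fun k => u (n + k)%N) c /\
    evt_lim (ejoins (fun k => u (n + k)%N)) c.
  by have [c] := ejoins_esup (fun k => u (n + k)%N); exists c.
have cb n : dB (c n) b <= r n.
  (* The errors [r (n + i).+1] for [i <= k] form a geometric sum, which telescopes by [rS]. Joining
     [b] with itself lets each new term contribute only its own distance to [b]. *)
  have jb k : dB (ejoins (fun k => u (n + k)%N) k) b <= r n - r (n + k).+1.
    elim: k => [|k ih] /=.
      by rewrite addn0 dB_sym; have := (hu n).2; have := rS n; lra.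
    rewrite -[X in dB _ X]ejoinxx; apply: le_trans (join_modulus pre _ _ _ _) _.
    have := (hu (n + k.+1)%N).2; rewrite [dB _ (u _)]dB_sym.
    by have := rS (n + k).+1; rewrite !addnS; lra.
  (* The bound passes to the limit: were it to fail, the excess would keep every partial join at
     least that far from [c n]. *)
  rewrite leNgt; apply/negP => lt; have [_ /(_ (dB (c n) b - r n))] := hc n.
  rewrite subr_gt0 => /(_ lt)[K _ hK]; have := hK K (leqnn K); rewrite /= dB_sym.
  have := dB_triangle (ejoins (fun k => u (n + k)%N) K) (c n) b.
  by have := jb K; have := r0 (n + K).+1; lra.
have bc n : ele b (c n) by apply: evt_lim_ele_le (ulim n) _; exact: (hc n).1.1.
rewrite -(enegK b); apply: sub_neg => //.
apply: (sub_sup hS (u := fun n => eneg (c n))) => [n|].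
  apply: sub_neg => //; apply: (sub_sup hS _ (hc n).1) => k; exact: (hu _).1.
split=> [n|s hs]; first exact: ele_neg.
apply: (evt_lim_ele_le (u := fun n => eneg (c n))) hs => e /rlim[K hK].
exists K => // k /= Kk; apply: le_lt_trans (neg_modulus pre _ _) _.
exact: le_lt_trans (cb k) (hK k Kk).
Qed.
End ModelsOfRandomization.

(** * Definable closure and metric closure *)

Section DefinableClosure.
Context {R : realType} {L : signature} {T : theory L} {N : interpretation R L}.
Hypothesis hN : is_model_of_randomization T N.
Implicit Type A : set (elt N).

Lemma dclB_sub_clB A : dclB A `<=` clB (fdclB A).
Proof.
move=> b [n [Phi [a [Aa hPhi]]]] e e0.
(* Budget: [Phi] is below [e'] at [b], hence below [3 * e'] at the perturbed event [x]. So [x] is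
   within [4 * e'] of [b], and the union of cells within [5 * e']. *)
have [e' e'01 e'e] : exists2 e' : R, 0 < e' <= 1 & 5 * e' <= e.
  exists (Num.min 1 (e / 5)).
    by rewrite lt_min ltr01 divr_gt0 //= ge_min lexx.
  by rewrite mulrC -ler_pdivlMr // ge_min lexx orbT.
have [K _ hK] := hPhi e' (andP e'01).1.
have {}hK x := hK K (leqnn K) x; rewrite /= in hK.
have [I [F hF]] := model_perturbation (Phi K) hN e'01.
have [x [c [h1 h2]]] := hF (a K) b.
exists (ev (pattern_union F c) (a K)); split.
  by exists (n K), (pattern_union F c), (a K).
have := hK x; have := hK b; rewrite (dB_refl hN) (dB_sym hN x).
by move: h1; rewrite !ltr_norml; lra.
Qed.

(** If [c] is near [b], then by the triangle inequality the formula [d(x, c)] approximates [d(x, b)]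
    uniformly in [x], with error at most [d(b, c)]. *)
Lemma clB_sub_dclB A : clB (fdclB A) `<=` dclB A.
Proof.
move=> b hb.
have /choice[t ht] k : exists t : {n & (formula L n * ('I_n -> elt N))%type},
    (forall i, A ((tagged t).2 i)) /\ dB b (ev (tagged t).1 (tagged t).2) < k.+1%:R^-1.
  have [|_ [[n [phi [a [Aa ->]]]] lt]] := hb k.+1%:R^-1; first by rewrite invr_gt0.
  by exists (existT _ n (phi, a)).
exists (fun k => tag (t k)),
  (fun k => CdB R (BVar L (tag (t k)) (ord0 : 'I_1)) (BEv 1 (tagged (t k)).1 id)),
  (fun k => (tagged (t k)).2).
split=> [k i|e e0]; first exact: (ht k).1.
have [K _ hK] := near_infty_natSinv_lt (PosNum e0).
exists K => // k /= Kk x; rewrite cons_env0.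
apply: le_lt_trans (hK k Kk); apply: le_trans (ltW (ht k).2).
have := dB_triangle hN b x (ev (tagged (t k)).1 (tagged (t k)).2).
have := dB_triangle hN (ev (tagged (t k)).1 (tagged (t k)).2) x b.
by rewrite (dB_sym hN (ev _ _) b) ler_norml; lra.
Qed.

End DefinableClosure.

Theorem theorem3p2 (R : realType) (L : signature) (T : theory L)
    (hT : complete_theory T) (hT2 : models_have_two_elements T)
    (N : interpretation R L) (hN : is_model_of_randomization T N)
    (A : set (elt N)) :
  dclB A = clB (fdclB A) /\ clB (fdclB A) = sigmaB (fdclB A).
Proof.
split; apply/seteqP; split.
- exact: dclB_sub_clB hN _.
- exact: clB_sub_dclB hN _.
(* Every competing sigma-subalgebra is metrically closed, so it contains the closure of what it
   contains. *)
- move=> b hb S [hS fS]; apply: (sigma_subalgebra_closed hN hS) => e /hb[c [hc bc]].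
  by exists c; split=> //; exact: fS.
(* The closure is itself one of the sigma-subalgebras being intersected. *)
- by move=> b; apply; split; [exact: clB_fdclB_sigma hN _|exact: sub_clB hN _].
Qed.
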